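(* Let $\vartheta>0$ be a constant and let $g(\delta)=\vartheta^{w(\delta)}$, where $w(\delta)$ is the number of cycles in the permutation divisor $\delta$. For $n\in\mathbb N$ and $\sigma\in\mathbb S_n$ let $$X_n(t)=X_n(\sigma,t)=\frac{1}{f(\sigma)}\sum_{\substack{\delta\mid\sigma\\ |\delta|\le tn}} g(\delta),\quad 0\le t\le 1,\qquad f(\sigma)=\sum_{\delta\mid\sigma}g(\delta).$$ Let $l\ge 1$ be an integer, $r=2^l-1$, and $\bar t=(t_1,\dots,t_l)\in(0,1]^l$. Then $$\lim_{n\to\infty}\mathbf E_n\Big(\prod_{i\le l}X_n(t_i)\Big)=\prod_{0\le m\le r}\Gamma\Big(\frac{\vartheta^{d(m)}}{(1+\vartheta)^{l}}\Big)^{-1}\int_{\Omega(\bar t)}\ \prod_{1\le m\le r}v_m^{\vartheta^{d(m)}(1+\vartheta)^{-l}-1}\,\big(1-s(\bar v)\big)^{(1+\vartheta)^{-l}-1}\,\mathrm d\bar v,$$ where $d(m)$ is the sum of the binary digits of $m$, $s(\bar v)=v_1+\cdots+v_r$ for $\bar v=(v_1,\dots,v_r)$, and $$\Omega(\bar t)=\Big\{\bar v\in[0,1]^r:\ \sum_{1\le m\le r}d_{i-1}(m)v_m\le t_i\ \text{ for all } 1\le i\le l,\ \ s(\bar v)\le 1\Big\},$$ with $d_j(m)\in\{0,1\}$ the $j$-th binary digit of $m$, i.e. $m=\sum_{j\ge0}d_j(m)2^j$.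
   Context: Every permutation $\sigma\in\mathbb S_n$ of $\{1,\dots,n\}$ decomposes uniquely into a set of disjoint cycles (fixed points count as cycles of length 1). A divisor $\delta$ of $\sigma$, written $\delta\mid\sigma$, is any subset (including the empty one) of this set of cycles. Its number of cycles is $w(\delta)$, and its size $|\delta|$ is the sum of the lengths of its cycles. $\mathbf E_n$ is the expectation with respect to the uniform probability measure on the symmetric group $\mathbb S_n$. *)

(* Defs.v *)
From HB Require Import structures.
From mathcomp Require Import all_boot all_order all_algebra all_fingroup.
From mathcomp Require Import all_classical all_reals all_analysis.

Set Implicit Arguments.
Unset Strict Implicit.
Unset Printing Implicit Defensive.

Import Order.TTheory GRing.Theory Num.Theory.
Import numFieldNormedType.Exports.

Local Open Scope classical_set_scope.
Local Open Scope ring_scope.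

Section divisors.
Variables (R : realType) (n : nat).
Implicit Types (s : {perm 'I_n}) (delta : {set {set 'I_n}}).

(* The cycles of s are encoded by their supports, i.e. the orbits of s (fixed  *)
(* points included); given s, the support determines the cycle.  A divisor of  *)
(* s is then a subset of porbits s.                                            *)
Definition divides delta s : bool := delta \subset porbits s.

Definition ncycles delta : nat := #|delta|.

Definition divisor_size delta : nat := (\sum_(c in delta) #|c|)%N.

Definition weight (theta : R) delta : R := theta ^+ ncycles delta.

Definition total_weight (theta : R) s : R :=
  \sum_(delta | divides delta s) weight theta delta.

Definition X (theta : R) s (t : R) : R :=
  (total_weight theta s)^-1 *
  \sum_(delta | divides delta s && ((divisor_size delta)%:R <= t * n%:R))
     weight theta delta.

Definition uniform_expectation (Y : {perm 'I_n} -> R) : R :=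
  (\sum_(s : {perm 'I_n}) Y s) / #|{perm 'I_n}|%:R.

End divisors.

Section tuple_lebesgue.
Variable R : realType.

Definition cons_pair n (p : measurableTypeR R * n.-tuple R) : n.+1.-tuple R :=
  [tuple of (p.1 : R) :: p.2].

Lemma measurable_cons_pair n : measurable_fun setT (@cons_pair n).
Proof. exact: (@measurable_cons _ _ _ R). Qed.

Section step.
Variables (n : nat) (mu : {sigma_finite_measure set (n.-tuple R) -> \bar R}).

Definition lebesgue_cons : set (n.+1.-tuple R) -> \bar R :=
  pushforward (@lebesgue_measure R \x mu)%E (@cons_pair n).

Let lebesgue_cons0 : lebesgue_cons set0 = 0%E.
Proof. by rewrite /lebesgue_cons /pushforward preimage_set0 measure0. Qed.

Let lebesgue_cons_ge0 A : (0 <= lebesgue_cons A)%E.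
Proof. by rewrite /lebesgue_cons /pushforward measure_ge0. Qed.

Let lebesgue_cons_sigma_additive : semi_sigma_additive lebesgue_cons.
Proof.
move=> F mF tF mUF; rewrite /lebesgue_cons /pushforward preimage_bigcup.
have mpre A : measurable A -> measurable (@cons_pair n @^-1` A).
  by move=> mA; rewrite -[X in measurable X]setTI; exact: measurable_cons_pair.
apply: measure_semi_sigma_additive.
- by move=> i; exact: mpre.
- apply/trivIsetP => /= i j _ _ ij; rewrite -preimage_setI.
  by move/trivIsetP : tF => /(_ _ _ _ _ ij) ->//; rewrite preimage_set0.
- by rewrite -preimage_bigcup; exact: mpre.
Qed.

HB.instance Definition _ := isMeasure.Build _ _ _ lebesgue_cons
  lebesgue_cons0 lebesgue_cons_ge0 lebesgue_cons_sigma_additive.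

Let lebesgue_cons_sigma_finite : sigma_finite setT lebesgue_cons.
Proof.
have /sigma_finiteP[F [TF ndF Foo]] := sigma_finiteT (@lebesgue_measure R).
have /sigma_finiteP[G [TG ndG Goo]] := sigma_finiteT mu.
pose H k := [set v : n.+1.-tuple R |
  F k (thead v) /\ G k [tuple of behead v]].
have HE k : @cons_pair n @^-1` H k = F k `*` G k.
  apply/seteqP; split=> -[x v] /=; rewrite /H /cons_pair /= theadE.
  - by move=> [Fx Gv]; split => //=; rewrite (_ : v = [tuple of behead [tuple of x :: v]])//; exact/val_inj.
  - by move=> [Fx Gv]; split => //=; rewrite (_ : [tuple of _] = v)//; exact/val_inj.
exists H.
  apply/esym/seteqP; split => // v _.
  have : (\bigcup_i F i) (thead v) by rewrite -TF.
  have : (\bigcup_i G i) [tuple of behead v] by rewrite -TG.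
  move=> [j _ Gj] [i _ Fi]; exists (maxn i j) => //; split.
  - by move: Fi; exact/subsetPset/ndF/leq_maxl.
  - by move: Gj; exact/subsetPset/ndG/leq_maxr.
move=> k; have [mF Fk] := Foo k; have [mG Gk] := Goo k; split.
- rewrite (_ : H k =
    (@tnth _ R ^~ ord0 @^-1` F k) `&`
    ((fun v : n.+1.-tuple R => [tuple of behead v]) @^-1` G k))//.
  apply: measurableI; rewrite -[X in measurable X]setTI.
  + exact: measurable_tnth.
  + exact: measurable_behead.
- rewrite /lebesgue_cons /pushforward HE product_measure1E//.
  by rewrite lte_mul_pinfty// ge0_fin_numE.
Qed.

HB.instance Definition _ :=
  Measure_isSigmaFinite.Build _ _ _ lebesgue_cons lebesgue_cons_sigma_finite.

End step.

(* Lebesgue measure on R^n (Borel sigma-algebra generated by the coordinates): *)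
(* the n-fold product of lebesgue_measure.                                     *)
Fixpoint lebesgue_tuple n : {sigma_finite_measure set (n.-tuple R) -> \bar R} :=
  match n with
  | 0 => \d_[tuple] : {sigma_finite_measure set (0.-tuple R) -> \bar R}
  | k.+1 => lebesgue_cons (lebesgue_tuple k)
  end.

Lemma lebesgue_tuple_box n (A : 'I_n -> set R) :
  (forall i, measurable (A i)) ->
  lebesgue_tuple n [set v | forall i, A i (tnth v i)] =
  (\prod_(i < n) lebesgue_measure (A i))%E.
Proof.
elim: n A => [|n IH] A mA; first by rewrite big_ord0 /= diracE mem_set// => -[].
have mB : measurable
    [set v : n.-tuple R | forall i : 'I_n, A (lift ord0 i) (tnth v i)].
  rewrite (_ : [set v : n.-tuple R |
      forall i : 'I_n, A (lift ord0 i) (tnth v i)] =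
    \bigcap_(i in [set: 'I_n]) ((@tnth n R ^~ i) @^-1` A (lift ord0 i))).
    apply: fin_bigcap_measurable => // i _.
    by rewrite -[X in measurable X]setTI; exact: measurable_tnth.
  by apply/seteqP; split => v /= h i; [move=> _|]; exact: h.
rewrite big_ord_recl /= /lebesgue_cons /pushforward.
rewrite (_ : _ @^-1` _ =
    A ord0 `*` [set v | forall i, A (lift ord0 i) (tnth v i)]); last first.
  apply/seteqP; split => -[x v] /= h.
    split; first by have := h ord0; rewrite /cons_pair.
    by move=> i; have := h (lift ord0 i); rewrite /cons_pair tnthS.
  by move=> i; case: (unliftP ord0 i) => [j ->|->];
    rewrite /cons_pair ?tnthS; [exact: h.2|exact: h.1].
rewrite product_measure1E//=; last exact: mA.
by congr (_ * _)%E; exact: (IH (fun i => A (lift ord0 i))).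
Qed.

End tuple_lebesgue.

(* Gamma function for a > 0; elsewhere the value has no meaning. *)
Definition Gamma (R : realType) (a : R) : R :=
  \int[lebesgue_measure]_(x in `]0%R, +oo[) (x `^ (a - 1) * expR (- x)).

Definition binary_digit (j m : nat) : bool := odd (m %/ 2 ^ j)%N.

(* The digits of index j >= m all vanish, as m < 2 ^ m. *)
Definition digit_sum (m : nat) : nat := (\sum_(j < m) binary_digit j m)%N.

Section dirichlet_side.
Variables (R : realType) (l : nat).

(* Coordinates are 0-indexed: the component i : 'I_r of v is v_(i+1), and the  *)
(* component i : 'I_l of t is t_(i+1), whose digit index is i.                 *)
Definition coord_sum r (v : r.-tuple R) : R := \sum_(i < r) tnth v i.

Definition Omega (t : l.-tuple R) : set ((2 ^ l - 1).-tuple R) :=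
  [set v | [/\ forall i, 0 <= tnth v i <= 1,
               forall i : 'I_l,
                 \sum_(m < 2 ^ l - 1) (binary_digit i m.+1)%:R * tnth v m
                   <= tnth t i
             & coord_sum v <= 1]].

Definition exponent (theta : R) (m : nat) : R :=
  theta ^+ digit_sum m / (1 + theta) ^+ l.

(* `^ has 0 `^ a = 0 for a != 0, so this differs from the usual density only    *)
(* on the null set where some v_m or 1 - s(v) vanishes.                        *)
Definition density (theta : R) (v : (2 ^ l - 1).-tuple R) : R :=
  (\prod_(m < 2 ^ l - 1) tnth v m `^ (exponent theta m.+1 - 1)) *
  (1 - coord_sum v) `^ (((1 + theta) ^+ l)^-1 - 1).

End dirichlet_side.

(* Main.v *)
Require Import Defs.
From HB Require Import structures.
From mathcomp Require Import all_boot all_order all_algebra all_fingroup.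
From mathcomp Require Import all_classical all_reals all_analysis.
From mathcomp Require Import measurable_realfun zify ring lra.

(* Recording for every point which of the l divisors contain its cycle turns a  *)
(* tuple of divisors of s into a word w : 'I_n -> {0, ..., 2^l - 1} constant on *)
(* the cycles of s, a cycle of colour m having weight a_m = exponent l theta m. *)
(* Summing over s, a word in which colour m occurs k_m times gets the weight    *)
(* n!^-1 prod_m a_m (a_m + 1) ... (a_m + k_m - 1).  As sum_m a_m = 1, this is   *)
(* the law of a Polya urn, that is, a mixture of the laws of i.i.d. words with  *)
(* letter distribution p, where p has the Dirichlet(a) distribution.  For fixed *)
(* p off the hyperplanes sum_m d_i(m) p_m = t_i, the law of large numbers shows *)
(* that the constraints on the divisor sizes hold with probability tending to 1 *)
(* or 0 according to whether p lies in Omega(t); dominated convergence          *)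
(* concludes.                                                                   *)

Set Implicit Arguments.
Unset Strict Implicit.
Unset Printing Implicit Defensive.

Import Order.TTheory GRing.Theory Num.Theory.
Import numFieldNormedType.Exports.

Local Open Scope ring_scope.

(** * Permutations with coloured cycles *)

(** Choosing l divisors of [s] amounts to giving each cycle a colour below [2 ^ l] whose digits say
    which divisors contain it. So the product of the [X theta s (tnth t i)] is the probability that
    independent cycle colours of law [exponent l theta] meet the size constraints ([prod_X]).
    Building permutations by inserting one point at a time, as in the Chinese restaurant process,
    turns the sum over [s] for a fixed word into a product of rising factorials, one per colour
    ([sum_preserving_perms], [expectation_prod_X]).

    Rising factorials are quotients of Gamma values ([Gamma_rising]), so [dirichlet_integral]
    rewrites such a product as an i.i.d. word probability integrated against the Dirichlet density
    ([polya_mixture]): de Finetti's representation of the Polya urn. For each n the expectation is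
    thus an exact integral ([expectation_integral]) in which n enters only through the probability
    that an i.i.d. word is admissible. Chebyshev's inequality drives that probability to an
    indicator ([admissible_prob_dist]), except on the null hyperplanes where a constraint is an
    equality ([hyperplane_null]), and the Dirichlet density itself is the dominating function. *)

Section coloured_permutations.
Variable T : finType.
Implicit Types (s : {perm T}) (x y z : T) (A S : {set T}).

Lemma porbit_min s A z : z \in A -> (forall u, u \in A -> s u \in A) ->
  porbit s z \subset A.
Proof.
move=> zA stA; apply/fintype.subsetP => u /porbitP[i ->].
by elim: i => [|i IH]; rewrite ?expg0 ?perm1// expgSr permM; exact: stA.
Qed.

Lemma mem_porbit_image s z u : u \in porbit s z -> s u \in porbit s z.
Proof. by rewrite -!eq_porbit_mem => /eqP <-; have /= -> := porbit_perm s 1 u. Qed.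

Lemma porbit_fixed s x : s x = x -> porbit s x = [set x].
Proof.
move=> sx; apply/eqP; rewrite finset.eqEsubset finset.sub1set porbit_id andbT.
by apply: porbit_min; rewrite ?inE// => u /[!inE] /eqP ->; rewrite sx.
Qed.

Lemma notin_porbit_fixed s x z : s x = x -> z != x -> x \notin porbit s z.
Proof. by move=> sx zx; rewrite porbit_sym porbit_fixed// inE. Qed.

Section merge.
Variables (s : {perm T}) (x y : T).
Hypotheses (sx : s x = x) (yx : y != x).
Let s' := (tperm x y * s)%g.

Definition merge_cycle A := if y \in A then x |: A else A.

Let s'x : s' x = s y. Proof. by rewrite permM tpermL. Qed.
Let s'y : s' y = x. Proof. by rewrite permM tpermR. Qed.
Let s'E u : u != x -> u != y -> s' u = s u.
Proof. by move=> ux uy; rewrite permM tpermD// eq_sym. Qed.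

(** [s'] sends [y] to [x] and [x] to [s y], and agrees with [s] elsewhere: the fixed point [x] is
    spliced into the cycle of [y], and the other cycles do not change. *)
Lemma porbit_merge z : z != x -> porbit s' z = merge_cycle (porbit s z).
Proof.
move=> zx; apply/eqP; rewrite finset.eqEsubset; apply/andP; split.
  apply: porbit_min => [|u]; rewrite /merge_cycle; case: ifPn => yz.
  - by rewrite !inE porbit_id orbT.
  - exact: porbit_id.
  - rewrite !inE; have [-> _|ux /= uz] := eqVneq u x.
      by rewrite s'x mem_porbit_image ?orbT.
    have [->|uy] := eqVneq u y; first by rewrite s'y eqxx.
    by rewrite s'E// mem_porbit_image ?orbT.
  - move=> uz; rewrite s'E ?mem_porbit_image//.
      by apply: contraTneq uz => ->; exact: notin_porbit_fixed.
    by apply: contraTneq uz => ->.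
have sub : porbit s z \subset porbit s' z.
  apply: (@fintype.subset_trans _ _ (porbit s' z :\ x)); last exact: subD1set.
  apply: porbit_min => [|u]; first by rewrite !inE zx porbit_id.
  (* The orbit under [s'] with [x] removed is [s]-stable: [s u] is [s' u], or [s' (s' u)] when
     [u = y]. *)
  rewrite !inE => /andP[ux uz]; rewrite -[X in s u != X]sx (inj_eq perm_inj) ux/=.
  have [uy|uy] := eqVneq u y; last by rewrite -s'E// mem_porbit_image.
  by rewrite uy -s'x -s'y mem_porbit_image// mem_porbit_image// -uy.
rewrite /merge_cycle; case: ifPn => // yz; rewrite finset.subUset sub andbT finset.sub1set.
by rewrite -s'y mem_porbit_image// (fintype.subsetP sub).
Qed.

Lemma porbit_merge_new : porbit s' x = porbit s' y.
Proof.
by apply/eqP; rewrite eq_porbit_mem -[X in X \in _]s'y mem_porbit_image// porbit_id.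
Qed.

End merge.

Section coloring.
Variables (R : comPzSemiRingType) (C : finType) (w : T -> C) (a : C -> R).
Variable wt : {set T} -> R.
Hypothesis wtE : forall (A : {set T}) x, x \in A ->
  (forall y, y \in A -> w y = w x) -> wt A = a (w x).

Definition preserves s := [forall x, w (s x) == w x].

Lemma preserves_porbit s x y : preserves s -> y \in porbit s x -> w y = w x.
Proof.
move=> /forallP ws /porbitP[i ->]; elim: i => [|i IH]; first by rewrite expg0 perm1.
by rewrite expgSr permM (eqP (ws _)).
Qed.

Lemma wt_porbit s x : preserves s -> wt (porbit s x) = a (w x).
Proof.
by move=> ws; apply: wtE; [exact: porbit_id|move=> y /(preserves_porbit ws)].
Qed.

Definition cycles_on S s := [set porbit s x | x in S].

(** Localised to permutations supported in [S], so that [T] can be built up point by point. The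
    values of [wt] are prescribed only on nonempty monochromatic sets, which all these cycles
    are. *)
Definition coloured_sum S : R :=
  \sum_(s : {perm T} | perm_on S s && preserves s) \prod_(A in cycles_on S s) wt A.

Lemma coloured_sum0 : coloured_sum finset.set0 = 1.
Proof.
rewrite /coloured_sum (big_pred1 1%g) => [|s /=].
  by rewrite /cycles_on imset0 big_set0.
apply/andP/eqP => [[s0 _]|->].
  by apply: perm_on_id s0 _; rewrite cards0.
by split; [exact: perm_on1|apply/forallP => x; rewrite perm1].
Qed.

Lemma prod_cycles_fixed S s x : x \notin S -> perm_on S s -> preserves s ->
  \prod_(A in cycles_on (x |: S) s) wt A =
  a (w x) * \prod_(A in cycles_on S s) wt A.
Proof.
move=> xS sS ws; have sx := out_perm sS xS.
rewrite /cycles_on imsetU1 big_setU1/= ?wt_porbit//.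
apply/imsetP => -[z zS xz]; have zx : z != x by apply: contraNneq xS => <-.
by have := notin_porbit_fixed sx zx; rewrite -xz porbit_id.
Qed.

(** Inserting [x] into a cycle of its own colour keeps the weight of that cycle, and deleting [x]
    undoes [merge_cycle], so distinct cycles stay distinct. *)
Lemma prod_cycles_merge S s x y : x \notin S -> y \in S -> perm_on S s ->
  preserves s -> w y = w x ->
  \prod_(A in cycles_on (x |: S) (tperm x y * s)%g) wt A =
  \prod_(A in cycles_on S s) wt A.
Proof.
move=> xS yS sS ws wyx; have sx := out_perm sS xS.
have yx : y != x by apply: contraNneq xS => <-.
have notx A : A \in cycles_on S s -> x \notin A.
  move=> /imsetP[z zS ->]; apply: notin_porbit_fixed => //.
  by apply: contraNneq xS => <-.
have -> : cycles_on (x |: S) (tperm x y * s)%g = merge_cycle x y @: cycles_on S s.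
  rewrite /cycles_on imsetU1 porbit_merge_new// -imset_comp.
  rewrite (finset.setUidPr _) ?finset.sub1set ?imset_f//.
  apply: eq_in_imset => z zS /=; rewrite porbit_merge//.
  by apply: contraNneq xS => <-.
rewrite big_imset => [|A B /notx xA /notx xB /(congr1 (fun E => E :\ x))].
  apply: eq_bigr => A AS; rewrite /merge_cycle; case: ifPn => // yA.
  have /imsetP[z zS EA] := AS; rewrite EA in yA *.
  rewrite wt_porbit// (wtE (x := x)) ?setU11//.
    by rewrite -wyx (preserves_porbit ws yA).
  move=> u /setU1P[->//|/(preserves_porbit ws) ->].
  by rewrite -wyx (preserves_porbit ws yA).
have mK (E : {set T}) : x \notin E -> merge_cycle x y E :\ x = E.
  move=> xE; rewrite /merge_cycle; case: ifP => _; first exact: setU1K.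
  by apply/finset.setDidPl; rewrite disjoint_sym disjoints1.
by rewrite !mK.
Qed.

Lemma preservesM s t : preserves s -> preserves t -> preserves (s * t)%g.
Proof.
move=> /forallP ws /forallP wt'; apply/forallP => x.
by rewrite permM (eqP (wt' _)).
Qed.

Lemma preserves_tperm x y : w y = w x -> preserves (tperm x y).
Proof. by move=> wyx; apply/forallP => z; case: tpermP => [->|->|]; rewrite ?wyx. Qed.

(** Multiplication by [tperm x y] is an involution that makes [y] the predecessor of a fixed point
    [x]. For [y = x] it is the identity, which covers the case where [x] stays fixed. *)
Lemma merge_domain S x y s : x \notin S -> y \in x |: S ->
  perm_on (x |: S) (tperm x y * s)%g && preserves (tperm x y * s)%g
    && (((tperm x y * s)^-1)%g x == y) =
  [&& perm_on S s, preserves s & w y == w x].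
Proof.
move=> xS yS.
have tS : perm_on (x |: S) (tperm x y).
  apply/fintype.subsetP => z; rewrite inE; apply: contraR => zS; apply/eqP.
  by apply: tpermD; apply: contraNneq zS => <-; rewrite ?setU11.
have -> : (((tperm x y * s)^-1)%g x == y) = (s x == x).
  by rewrite -(inj_eq (@perm_inj _ (tperm x y * s)%g)) permKV permM tpermR eq_sym.
apply/andP/and3P => [[/andP[sS ws] /eqP sx]|[sS ws /eqP wyx]]; last first.
  have sx := out_perm sS xS; split; last exact/eqP.
  rewrite preservesM ?preserves_tperm// andbT perm_onM//.
  by apply: fintype.subset_trans sS _; exact: finset.subsetUr.
have wyx : w y = w x.
  by have /forallP/(_ y) := ws; rewrite permM tpermR sx => /eqP.
have sE : s = (tperm x y * (tperm x y * s))%g by rewrite mulgA tperm2 mul1g.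
split; last exact/eqP.
  have {}sS : perm_on (x |: S) s by rewrite sE perm_onM.
  apply/fintype.subsetP => z; rewrite inE => sz.
  have /setU1P[zx|//] := fintype.subsetP sS z sz.
  by rewrite zx sx eqxx in sz.
by rewrite sE preservesM ?preserves_tperm.
Qed.

(* x is either a new fixed point or inserted right after some y in S; the latter *)
(* enlarges a cycle without changing its weight, and forces w y = w x.           *)
Lemma coloured_sumU1 S x : x \notin S ->
  coloured_sum (x |: S) =
  coloured_sum S * (a (w x) + #|[set y in S | w y == w x]|%:R).
Proof.
move=> xS; rewrite {1}/coloured_sum.
rewrite (partition_big (fun s => (s^-1)%g x) (fun y => y \in x |: S))/=; last first.
  move=> s /andP[sS _]; rewrite -(perm_closed _ sS) permKV; exact: setU11.
have reidx y : y \in x |: S ->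
  \sum_(s | perm_on (x |: S) s && preserves s && ((s^-1)%g x == y))
    \prod_(A in cycles_on (x |: S) s) wt A =
  \sum_(s | [&& perm_on S s, preserves s & w y == w x])
    \prod_(A in cycles_on (x |: S) (tperm x y * s)%g) wt A.
  move=> yS; rewrite (reindex_inj (mulgI (tperm x y)))/=.
  by apply: eq_bigl => s; exact: merge_domain.
rewrite big_setU1//= reidx ?setU11// mulrDr; congr (_ + _).
  rewrite /coloured_sum mulrC big_distrr/=; apply: eq_big => [s|s /and3P[sS ws _]].
    by rewrite eqxx andbT.
  by rewrite tperm1 mul1g prod_cycles_fixed.
transitivity (\sum_(y in S | w y == w x) coloured_sum S).
  rewrite big_mkcondr; apply: eq_bigr => y yS; rewrite reidx ?setU1r//.
  case: ifPn => wyx; last by rewrite big_pred0// => s; rewrite !andbF.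
  apply: eq_big => [s|s /and3P[sS ws _]]; first by rewrite andbT.
  by rewrite prod_cycles_merge//; exact/eqP.
by rewrite sumr_const mulr_natr; congr (_ *+ _); apply: eq_card => y; rewrite !inE.
Qed.

(** Points may be added in any order: a point of colour [m] arriving when k points of that colour
    are present contributes the factor [a m + k]. *)
Lemma coloured_sumE S : coloured_sum S =
  \prod_(m : C) \prod_(i < #|[set y in S | w y == m]|) (a m + i%:R).
Proof.
have [n] := ubnP #|S|; elim: n S => // n IH S leSn.
have [->|[x xS]] := set_0Vmem S.
  rewrite coloured_sum0 big1// => m _.
  rewrite (_ : [set y in finset.set0 | _] = finset.set0) ?cards0 ?big_ord0//.
  by apply/setP => y; rewrite !inE.
have xS' : x \notin S :\ x by rewrite !inE eqxx.
rewrite -(finset.setD1K xS) coloured_sumU1// IH; last first.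
  by move: leSn; rewrite [#|S|](cardsD1 x) xS.
rewrite [LHS]mulrC (bigD1 (w x))//= mulrA [RHS](bigD1 (w x))//=; congr (_ * _).
  have -> : #|[set y in x |: S :\ x | w y == w x]| = #|[set y in S :\ x | w y == w x]|.+1.
    rewrite (cardsD1 x) !inE !eqxx/= add1n; congr _.+1; apply: eq_card => y.
    by rewrite !inE; case: (eqVneq y x).
  by rewrite big_ord_recr/= mulrC.
apply: eq_bigr => m mx.
suff -> : #|[set y in x |: S :\ x | w y == m]| = #|[set y in S :\ x | w y == m]| by [].
apply: eq_card => y.
by rewrite !inE; case: (eqVneq y x) => // ->; rewrite eq_sym (negbTE mx) andbF.
Qed.

Lemma sum_preserving_perms :
  \sum_(s : {perm T} | preserves s) \prod_(A in porbits s) wt A =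
  \prod_(m : C) \prod_(i < #|[set y | w y == m]|) (a m + i%:R).
Proof.
have := coloured_sumE [set: T].
under [in X in _ = X -> _]eq_bigr do under eq_finset do rewrite inE.
move=> <-; apply: eq_big => [s|s _].
  by suff -> : perm_on [set: T] s by []; apply/fintype.subsetP => x; rewrite inE.
apply: eq_bigl => A.
by apply/imsetP/imsetP => -[x _ ->]; exists x.
Qed.

End coloring.
End coloured_permutations.

(** * Binary digits: coding l yes/no choices by one number *)

Section binary_digits.

Lemma binary_digit0 m : binary_digit 0 m = odd m.
Proof. by rewrite /binary_digit expn0 divn1. Qed.

Lemma binary_digitS j m : binary_digit j.+1 m = binary_digit j m./2.
Proof. by rewrite /binary_digit expnS divnMA divn2. Qed.

Definition of_digits l (b : nat -> bool) : nat := (\sum_(i < l) b i * 2 ^ i)%N.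

Lemma of_digitsS l b :
  of_digits l.+1 b = (b 0%N + (of_digits l (fun i => b i.+1)).*2)%N.
Proof.
rewrite /of_digits big_ord_recl expn0 muln1 -muln2 big_distrl/=; congr addn.
by apply: eq_bigr => i _; rewrite /bump/= add1n expnSr mulnA.
Qed.

Lemma of_digits_lt l b : (of_digits l b < 2 ^ l)%N.
Proof.
elim: l b => [|l IH] b; first by rewrite /of_digits big_ord0.
by rewrite of_digitsS expnS; have := IH (fun i => b i.+1); case: (b 0%N); lia.
Qed.

Lemma binary_digit_of_digits l b j : (j < l)%N ->
  binary_digit j (of_digits l b) = b j.
Proof.
elim: l b j => // l IH b [|j] jl; rewrite of_digitsS.
  by rewrite binary_digit0 oddD odd_double addbF oddb.
by rewrite binary_digitS half_bit_double IH.
Qed.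

Lemma binary_digit_inj l m m' : (m < 2 ^ l)%N -> (m' < 2 ^ l)%N ->
  (forall j, (j < l)%N -> binary_digit j m = binary_digit j m') -> m = m'.
Proof.
elim: l m m' => [|l IH] m m'; first by rewrite expn0 !ltnS !leqn0 => /eqP-> /eqP->.
rewrite expnS => ml ml' mm'; rewrite -(odd_double_half m) -(odd_double_half m').
rewrite -!binary_digit0 mm'//; congr (_ + _.*2)%N; apply: IH => [||j jl]; try lia.
by rewrite -!binary_digitS mm'.
Qed.

Lemma sum_binary_digit k K m : (k <= K)%N -> (m < 2 ^ k)%N ->
  (\sum_(j < K) binary_digit j m = \sum_(j < k) binary_digit j m)%N.
Proof.
move=> kK mk; rewrite -!(big_mkord xpredT (fun j => nat_of_bool (binary_digit j m))).
rewrite (big_cat_nat (n := k))//= -[RHS]addn0; congr addn.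
rewrite big_nat big1// => j /andP[kj _].
by rewrite /binary_digit divn_small// (leq_trans mk)// leq_exp2l.
Qed.

Lemma digit_sumE l m : (m < 2 ^ l)%N ->
  digit_sum m = (\sum_(j < l) binary_digit j m)%N.
Proof.
move=> ml; rewrite /digit_sum; have [lm|ml'] := leqP l m.
  by rewrite (sum_binary_digit lm).
by rewrite (sum_binary_digit (ltnW ml'))// ltn_expl.
Qed.

End binary_digits.

(** * From tuples of divisors to coloured words *)

Section divisors_theory.
Variables (R : realType) (n : nat) (theta : R).
Hypothesis theta_gt0 : 0 < theta.
Implicit Types (s : {perm 'I_n}) (delta : {set {set 'I_n}}).

(** Expanding the product of [theta + 1] over the cycles gives one term per subset of cycles. *)
Lemma total_weightE s : total_weight theta s = (1 + theta) ^+ #|porbits s|.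
Proof.
rewrite -prodr_const big_mkcond/=.
rewrite [RHS](_ : _ = \prod_A ((if A \in porbits s then theta else 0) + 1)); last first.
  by apply: eq_bigr => A _; case: ifP => _; rewrite ?add0r// addrC.
rewrite bigA_distr /total_weight big_mkcond/=; apply: eq_bigr => delta _.
rewrite /weight /ncycles -prodr_const big_mkcond/=.
case: ifPn => [/fintype.subsetP sub|/fintype.subsetPn[A Ad As]].
  by apply: eq_bigr => A _; case: ifPn => // /sub ->.
by rewrite (bigD1 A)//= Ad (negbTE As) mul0r.
Qed.

Lemma divisor_sizeE s delta : divides delta s ->
  divisor_size delta = #|[set x | porbit s x \in delta]|.
Proof.
move=> /fintype.subsetP ds; rewrite -sum1_card.
rewrite (partition_big (porbit s) (mem delta))/=; last by move=> x; rewrite inE.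
apply: eq_bigr => A Ad; rewrite -sum1_card; apply: eq_bigl => x.
rewrite inE; have /imsetP[y _ AE] := ds _ Ad.
by rewrite AE -eq_porbit_mem; case: eqP => [->|]; rewrite ?andbF// -AE Ad.
Qed.

End divisors_theory.

Section words.
Variables (R : realType) (l n : nat).
Local Notation word := {ffun 'I_n -> 'I_(2 ^ l - 1).+1}.
Implicit Types (s : {perm 'I_n}) (w : word) (f : {ffun 'I_l -> {set {set 'I_n}}}).

(** The colour type is written ['I_(2 ^ l - 1).+1] so that colour 0, that of cycles lying in no
    divisor, splits off as [ord0]; the remaining colours match the coordinates of [v]. *)
Definition word_divisors s w : {ffun 'I_l -> {set {set 'I_n}}} :=
  [ffun i : 'I_l => [set A in porbits s | [exists x in A, binary_digit i (w x)]]].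

Definition divisors_word s f : word :=
  [ffun x => inord (of_digits l
    (fun i => [exists j : 'I_l, (j == i :> nat) && (porbit s x \in f j)]))].

Lemma colour_bound : (2 ^ l - 1).+1 = (2 ^ l)%N.
Proof. by rewrite subn1 prednK ?expn_gt0. Qed.

Lemma colour_lt (m : 'I_(2 ^ l - 1).+1) : (m < 2 ^ l)%N.
Proof. by apply: leq_trans (ltn_ord m) _; rewrite colour_bound. Qed.

Lemma binary_digit_divisors_word s f (i : 'I_l) x :
  binary_digit i (divisors_word s f x) = (porbit s x \in f i).
Proof.
rewrite ffunE inordK; last by rewrite colour_bound of_digits_lt.
rewrite binary_digit_of_digits//; apply/existsP/idP => [[j /andP[/eqP ji]]|fi].
  by rewrite (val_inj ji).
by exists i; rewrite eqxx.
Qed.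

Lemma eq_word w w' :
  (forall (i : 'I_l) x, binary_digit i (w x) = binary_digit i (w' x)) -> w = w'.
Proof.
move=> ww'; apply/ffunP => x; apply: val_inj.
apply: (@binary_digit_inj l) => [||j jl]; try exact: colour_lt.
exact: (ww' (Ordinal jl)).
Qed.

Lemma mem_word_divisors s w (i : 'I_l) x : preserves w s ->
  (porbit s x \in word_divisors s w i) = binary_digit i (w x).
Proof.
move=> ws; rewrite ffunE inE imset_f//=.
apply/existsP/idP => [[y /andP[yx]]|wx]; first by rewrite (preserves_porbit ws yx).
by exists x; rewrite porbit_id.
Qed.

Lemma divisors_wordK s f : (forall i, divides (f i) s) ->
  word_divisors s (divisors_word s f) = f.
Proof.
move=> fs; have ws : preserves (divisors_word s f) s.
  apply/forallP => x; apply/eqP/val_inj; congr (val (_ : 'I__)).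
  by rewrite !ffunE; have /= -> := porbit_perm s 1 x.
apply/ffunP => i; apply/setP => A.
have [/imsetP[x _ ->]|As] := boolP (A \in porbits s).
  by rewrite mem_word_divisors// binary_digit_divisors_word.
rewrite ffunE inE (negbTE As)/=; apply/esym/negbTE.
by apply: contraNN As; exact/fintype.subsetP/fs.
Qed.

(** Not every word is a code, only those constant on the cycles. The boolean equation is the side
    condition that [reindex_onto] produces in [prod_X]. *)
Lemma word_divisorsK s w :
  (divisors_word s (word_divisors s w) == w) = preserves w s.
Proof.
apply/eqP/idP => [<-|ws].
  apply/forallP => x; apply/eqP/val_inj; congr (val (_ : 'I__)).
  by rewrite !ffunE; have /= -> := porbit_perm s 1 x.
by apply: eq_word => i x; rewrite binary_digit_divisors_word mem_word_divisors.
Qed.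

Definition admissible (t : l.-tuple R) w :=
  [forall i : 'I_l, #|[set x | binary_digit i (w x)]|%:R <= tnth t i * n%:R].

Definition cycle_weight (theta : R) w (A : {set 'I_n}) : R :=
  (\prod_(i < l) if [exists x in A, binary_digit i (w x)] then theta else 1)
  / (1 + theta) ^+ l.

Lemma cycle_weightE theta w (A : {set 'I_n}) x : x \in A ->
  (forall y, y \in A -> w y = w x) -> cycle_weight theta w A = exponent l theta (w x).
Proof.
move=> xA wA; rewrite /cycle_weight /exponent (@digit_sumE l) ?colour_lt//.
congr (_ / _); rewrite expr_sum; apply: eq_bigr => i _.
suff -> : [exists y in A, binary_digit i (w y)] = binary_digit i (w x).
  by case: (binary_digit _ _).
apply/existsP/idP => [[y /andP[yA]]|wx]; first by rewrite wA.
by exists x; rewrite xA.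
Qed.

Lemma prod_X (theta : R) (t : l.-tuple R) s : 0 < theta ->
  \prod_(i < l) X theta s (tnth t i) =
  \sum_(w | admissible t w && preserves w s)
    \prod_(A in porbits s) cycle_weight theta w A.
Proof.
move=> theta0; rewrite /X big_split/= bigA_distr_big_dep/= prodr_const card_ord.
rewrite total_weightE// (reindex_onto (word_divisors s) (divisors_word s))/=; last first.
  by move=> f /familyP fs; apply: divisors_wordK => i; have /andP[] := fs i.
rewrite big_distrr/=; apply: eq_big => [w|w /andP[_]].
  rewrite word_divisorsK; case: (boolP (preserves w s)) => ws; rewrite ?andbF// !andbT.
  have dw i : divides (word_divisors s w i) s.
    by apply/fintype.subsetP => A; rewrite ffunE inE => /andP[].
  have sw i : divisor_size (word_divisors s w i) = #|[set x | binary_digit i (w x)]|.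
    rewrite (divisor_sizeE (dw i)); congr #|pred_of_set _|; apply/setP => x.
    by rewrite !inE mem_word_divisors.
  apply/familyP/forallP => H i; have := H i; rewrite unfold_in/= sw ?dw//.
rewrite word_divisorsK => ws.
rewrite [in RHS]/cycle_weight big_split/= prodr_const mulrC.
(* The l total weights, each [1 + theta] to the number of cycles, regroup as one [(1 + theta) ^+ l]
   per cycle. *)
congr (_ * _); last by rewrite !exprVn -!exprM mulnC.
rewrite exchange_big/=.
apply: eq_bigr => i _; rewrite -big_mkcondr/= prodr_const /weight /ncycles.
congr (_ ^+ _); apply: eq_card => A; rewrite ffunE !inE.
by [].
Qed.

Lemma expectation_prod_X (theta : R) (t : l.-tuple R) : 0 < theta ->
  uniform_expectation (fun s : {perm 'I_n} => \prod_(i < l) X theta s (tnth t i)) =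
  \sum_(w | admissible t w)
    (\prod_(m : 'I_(2 ^ l - 1).+1)
       \prod_(i < #|[set x | w x == m]|) (exponent l theta m + i%:R)) / n`!%:R.
Proof.
move=> theta0; rewrite /uniform_expectation -mulr_suml.
have -> : #|{perm 'I_n}| = n`! by rewrite -card_Sn; apply: eq_card.
congr (_ / _); under eq_bigr do rewrite prod_X//.
rewrite (exchange_big_dep (admissible t))/=; last by move=> s w _ /andP[].
apply: eq_bigr => w tw; under eq_bigl do rewrite tw.
rewrite -(@sum_preserving_perms _ _ _ w (exponent l theta) (cycle_weight theta w))//.
by move=> A x; exact: cycle_weightE.
Qed.

End words.

(** * The law of large numbers for random words *)

Section word_probability.
Variables (R : realType) (C : finType) (p : C -> R) (n : nat).
Local Notation word := {ffun 'I_n -> C}.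
Implicit Types (w : word) (h : C -> R).

Definition word_prob (w : word) : R := \prod_j p (w j).

Lemma word_probE w : word_prob w = \prod_c p c ^+ #|[set j | w j == c]|.
Proof.
rewrite /word_prob (partition_big w xpredT)//=; apply: eq_bigr => c _.
rewrite -prodr_const; apply: eq_big => [j|j /eqP ->//]; by rewrite inE.
Qed.

Hypothesis p_sum1 : \sum_c p c = 1.

Lemma word_prob_sum1 : \sum_(w : word) word_prob w = 1.
Proof. by rewrite -(bigA_distr_bigA (fun _ => p)) p_sum1 prodr_const expr1n. Qed.

Lemma word_prob_variance h : \sum_c p c * h c = 0 ->
  \sum_(w : word) word_prob w * (\sum_j h (w j)) ^+ 2 =
  n%:R * \sum_c p c * h c ^+ 2.
Proof.
move=> h0.
have cov j k : \sum_(w : word) word_prob w * (h (w j) * h (w k)) =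
    (\sum_c p c * h c ^+ 2) *+ (j == k).
  (* Writing the summand as a product over positions lets the sum over words factor. For [j != k]
     the factor at [j] is the mean of [h], which is 0. *)
  pose F x c := p c * ((if x == j then h c else 1) * (if x == k then h c else 1)).
  transitivity (\sum_(w : word) \prod_x F x (w x)).
    apply: eq_bigr => w _; rewrite /F !big_split/= -!big_mkcond/=.
    by rewrite !big_pred1_eq.
  rewrite -bigA_distr_bigA (bigD1 j)//= /F eqxx; case: (eqVneq j k) => [<-|jk].
    rewrite [X in _ * X]big1 ?mulr1 => [|x xj]; first by apply: eq_bigr.
    by under eq_bigr do rewrite (negbTE xj) !mulr1.
  by under eq_bigr do rewrite mulr1; rewrite h0 mul0r.
under eq_bigr => w _ do rewrite expr2 mulr_suml mulr_sumr.
under eq_bigr => w _ do under eq_bigr => j _ do rewrite mulr_sumr mulr_sumr.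
rewrite exchange_big/= (eq_bigr (fun=> \sum_c p c * h c ^+ 2)) => [|j _].
  by rewrite sumr_const card_ord mulr_natl.
rewrite exchange_big/= (eq_bigr _ (fun k _ => cov j k)) (bigD1 j)//= eqxx mulr1n.
by rewrite [X in _ + X]big1 ?addr0// => k; rewrite eq_sym => /negbTE ->.
Qed.

Hypothesis p_ge0 : forall c, 0 <= p c.

Lemma word_prob_ge0 w : 0 <= word_prob w.
Proof. exact: prodr_ge0. Qed.

(** The centred indicator of [d] is at most 1 in absolute value, so the variance of its sum over the
    word is at most n. The sign of [e] is free, so deviations on either side are covered. *)
Lemma word_prob_chebyshev (d : pred C) (e : R) (bad : pred word) :
  (0 < n)%N -> e != 0 ->
  (forall w, bad w -> (e * n%:R) ^+ 2 <=
     (#|[set j | d (w j)]|%:R - (\sum_(c | d c) p c) * n%:R) ^+ 2) ->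
  \sum_(w | bad w) word_prob w <= (e ^+ 2)^-1 / n%:R.
Proof.
set q := \sum_(c | d c) p c => n0 e0 badP; pose h c : R := (d c)%:R - q.
have q01 : 0 <= q <= 1.
  rewrite sumr_ge0//= -p_sum1 [leRHS](bigID d)/= lerDl sumr_ge0//.
have h0 : \sum_c p c * h c = 0.
  under eq_bigr do rewrite mulrBr.
  rewrite sumrB -mulr_suml p_sum1 mul1r /q [X in _ - X]big_mkcond/= -sumrB big1// => c _.
  by case: ifP => _; rewrite ?mulr1 ?mulr0 subrr.
have h2 : \sum_c p c * h c ^+ 2 <= 1.
  rewrite -p_sum1; apply: ler_sum => c _; rewrite ler_piMr// /h.
  by move/andP: q01 => [q0 q1]; case: (d c); rewrite /=; nra.
have nn0 : 0 < n%:R :> R by rewrite ltr0n.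
have en0 : 0 < (e * n%:R) ^+ 2 by rewrite exprn_even_gt0//= mulf_neq0// gt_eqF.
have sumE w : \sum_j h (w j) = #|[set j | d (w j)]|%:R - q * n%:R.
  rewrite sumrB sumr_const card_ord mulr_natr -natr_sum -sum1dep_card; congr (_%:R - _).
  by rewrite [RHS]big_mkcond/=.
(* Markov's inequality: on [bad] the inserted quotient is at least 1. *)
apply: (@le_trans _ _ (\sum_w word_prob w * ((\sum_j h (w j)) ^+ 2 / (e * n%:R) ^+ 2))).
  rewrite [leLHS]big_mkcond/=; apply: ler_sum => w _; case: ifPn => bw.
    by rewrite ler_peMr ?word_prob_ge0// ler_pdivlMr// mul1r sumE badP.
  by rewrite mulr_ge0 ?word_prob_ge0// divr_ge0 ?sqr_ge0.
under eq_bigr do rewrite mulrA.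
rewrite -mulr_suml word_prob_variance// ler_pdivrMr//.
rewrite exprMn (_ : _ / _ * _ = n%:R); last by field; rewrite e0 gt_eqF.
by rewrite ler_piMr.
Qed.

End word_probability.

Section admissible_probability.
Variables (R : realType) (l : nat) (t : l.-tuple R).
Variable p : 'I_(2 ^ l - 1).+1 -> R.
Hypotheses (p_sum1 : \sum_c p c = 1) (p_ge0 : forall c, 0 <= p c).

Definition admissible_prob n : R :=
  \sum_(w : {ffun 'I_n -> 'I_(2 ^ l - 1).+1} | admissible t w) word_prob p w.

Definition digit_prob (i : 'I_l) : R := 
  \sum_(c : 'I_(2 ^ l - 1).+1 | binary_digit i c) p c.

Lemma admissible_prob_itv n : 0 <= admissible_prob n <= 1.
Proof.
rewrite sumr_ge0 => [|w _]; last exact: word_prob_ge0.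
rewrite -(word_prob_sum1 n p_sum1) [leRHS](bigID (@admissible R l n t))/= lerDl.
by rewrite sumr_ge0// => w _; exact: word_prob_ge0.
Qed.

(** If every mean is below its threshold, a union bound over the constraints controls the
    inadmissible words. If the mean of index [i0] exceeds its threshold, every admissible word
    deviates at [i0]. Both cases use Chebyshev with deviation [digit_prob i - tnth t i]. *)
Lemma admissible_prob_dist n : (0 < n)%N -> (forall i, digit_prob i != tnth t i) ->
  `|admissible_prob n - [forall i, digit_prob i < tnth t i]%:R| <=
  (\sum_i ((digit_prob i - tnth t i) ^+ 2)^-1) / n%:R.
Proof.
move=> n0 qt; have nn0 : 0 < n%:R :> R by rewrite ltr0n.
have cheb i (bad : pred {ffun 'I_n -> 'I_(2 ^ l - 1).+1}) :
    (forall w, bad w -> ((digit_prob i - tnth t i) * n%:R) ^+ 2 <=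
      (#|[set x | binary_digit i (w x)]|%:R - digit_prob i * n%:R) ^+ 2) ->
    \sum_(w | bad w) word_prob p w <= ((digit_prob i - tnth t i) ^+ 2)^-1 / n%:R.
  move=> badP; apply: (word_prob_chebyshev p_sum1 p_ge0
    (d := fun c : 'I_(2 ^ l - 1).+1 => binary_digit i c)) => //.
  by rewrite subr_eq0.
case: (boolP [forall i, digit_prob i < tnth t i]) => [/forallP qlt|/forallPn[i0]].
  have -> : `|admissible_prob n - true%:R| =
      \sum_(w : {ffun 'I_n -> 'I_(2 ^ l - 1).+1} | ~~ admissible t w) word_prob p w.
    rewrite -[true%:R](word_prob_sum1 n p_sum1) [X in _ - X](bigID (@admissible R l n t))/=.
    rewrite opprD addrA subrr add0r normrN ger0_norm// sumr_ge0// => w _.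
    exact: word_prob_ge0.
  have tail (i : 'I_l) : \sum_(w : {ffun 'I_n -> 'I_(2 ^ l - 1).+1} |
        ~~ (#|[set x | binary_digit i (w x)]|%:R <= tnth t i * n%:R)) word_prob p w <=
      ((digit_prob i - tnth t i) ^+ 2)^-1 / n%:R.
    apply: cheb => w; rewrite -ltNge => tK.
    have A : 0 <= (tnth t i - digit_prob i) * n%:R by rewrite mulr_ge0// subr_ge0 ltW.
    by rewrite -[leLHS]sqrrN -mulNr opprB ler_sqr ?nnegrE; lra.
  rewrite mulr_suml; apply: (le_trans _ (ler_sum _ (fun i _ => tail i))).
  under [leRHS]eq_bigr do rewrite big_mkcond/=.
  rewrite exchange_big/= big_mkcond/=; apply: ler_sum => w _.
  have ge0 (i : 'I_l) : 0 <= (if ~~ (#|[set x | binary_digit i (w x)]|%:R <= tnth t i * n%:R)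
    then word_prob p w else 0) by case: ifP => // _; exact: word_prob_ge0.
  case: ifPn => [/forallPn[i wi]|_]; last exact: sumr_ge0.
  by rewrite (bigD1 i)//= wi lerDl sumr_ge0.
rewrite -leNgt => tq; rewrite subr0 ger0_norm; last by case/andP: (admissible_prob_itv n).
apply: (@le_trans _ _ (((digit_prob i0 - tnth t i0) ^+ 2)^-1 / n%:R)).
  apply: cheb => w /forallP/(_ i0) tK.
  have A : 0 <= (digit_prob i0 - tnth t i0) * n%:R by rewrite mulr_ge0// subr_ge0.
  by rewrite -[leRHS]sqrrN ler_sqr ?nnegrE; lra.
rewrite ler_pM2r ?invr_gt0// (bigD1 i0)//= lerDl sumr_ge0// => i _.
by rewrite invr_ge0 sqr_ge0.
Qed.

End admissible_probability.

(** * The colour weights form a probability vector *)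

Section exponent_theory.
Variables (R : realType) (theta : R).
Hypothesis theta_gt0 : 0 < theta.

Lemma digit_sum_double m (b : bool) : digit_sum (b + m.*2) = (b + digit_sum m)%N.
Proof.
have lt2 : (b + m.*2 < 2 ^ m.+1)%N.
  by have := ltn_expl m (isT : 1 < 2)%N; rewrite expnS; case: b; lia.
rewrite (digit_sumE lt2) big_ord_recl/= binary_digit0 oddD odd_double addbF oddb.
congr addn; apply: eq_bigr => j _.
by rewrite binary_digitS half_bit_double.
Qed.

Lemma sum_double (F : nat -> R) N :
  \sum_(m < N.*2) F m = \sum_(m < N) (F m.*2 + F m.*2.+1).
Proof.
elim: N => [|N IH]; first by rewrite !big_ord0.
by rewrite doubleS !big_ord_recr/= IH addrA.
Qed.

(** Splitting [m] by parity, the last digit contributes a factor [1 + theta]. *)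
Lemma sum_digit_sum l : \sum_(m < 2 ^ l) theta ^+ digit_sum m = (1 + theta) ^+ l.
Proof.
elim: l => [|l IH].
  by rewrite expn0 big_ord1 /digit_sum big_ord0 !expr0.
rewrite expnS mul2n (sum_double (fun m => theta ^+ digit_sum m)) exprS -IH mulr_sumr.
apply: eq_bigr => m _.
rewrite -[m.*2]add0n -[(0 + _).+1]add1n (digit_sum_double m false) (digit_sum_double m true).
by rewrite add0n exprS mulrDl mul1r.
Qed.

Lemma exponent_sum1 l : \sum_(m < (2 ^ l - 1).+1) exponent l theta m = 1.
Proof.
rewrite -mulr_suml subn1 prednK ?expn_gt0// sum_digit_sum divff// gt_eqF//.
by rewrite exprn_gt0 ?addr_gt0.
Qed.

Lemma exponent_gt0 l m : 0 < exponent l theta m.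
Proof. by rewrite divr_gt0 ?exprn_gt0 ?addr_gt0. Qed.

(** For [0 < l] there are at least two colours, all of positive weight. Strictness makes the powers
    [exponent l theta m - 1] nonzero, which settles their value at 0 in [density_Omega]. *)
Lemma exponent_lt1 l (m : 'I_(2 ^ l - 1).+1) : (0 < l)%N -> exponent l theta m < 1.
Proof.
move=> l0; have r0 : (0 < 2 ^ l - 1)%N by rewrite subn_gt0 -{1}(expn0 2) ltn_exp2l.
have [m' mm'] : exists m' : 'I_(2 ^ l - 1).+1, m' != m.
  have [->|m0] := eqVneq m ord0; last by exists ord0; rewrite eq_sym.
  by exists ord_max; rewrite -val_eqE/= -lt0n.
rewrite -(exponent_sum1 l) (bigD1 m)//= ltrDl (bigD1 m')//=.
by rewrite ltr_pwDl ?exponent_gt0// sumr_ge0// => i _; rewrite ltW ?exponent_gt0.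
Qed.

End exponent_theory.

(** * Gamma, beta and Dirichlet integrals *)

Local Open Scope classical_set_scope.

Section lebesgue_affine.
Context {R : realType}.
Local Notation mu := (@lebesgue_measure R).
Local Open Scope ereal_scope.

(** By uniqueness of Lebesgue measure it suffices to compare measures of half-open intervals; the
    dilation formula below is obtained in the same way. *)
Lemma ge0_integral_translation (c : R) (f : R -> \bar R) :
  measurable_fun [set: R] f -> (forall x, 0 <= f x) ->
  \int[mu]_x f (x + c)%R = \int[mu]_x f x.
Proof.
move=> mf f0.
pose phi : measurableTypeR R -> measurableTypeR R := fun x : R => (x + c)%R.
have mphi : measurable_fun setT phi by exact: measurable_funD.
transitivity (\int[pushforward mu phi]_y f y).
  by rewrite ge0_integral_pushforward.
apply: eq_measure_integral => //= A mA _.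
apply/esym/lebesgue_measure_unique => //= _ [[a b]] _ <-.
rewrite /pushforward /phi (_ : _ @^-1` _ = `](a - c)%R, (b - c)%R]%classic); last first.
  by apply/seteqP; split => x /=; rewrite !in_itv/= ltrBlDr lerBrDr.
rewrite !lebesgue_measure_itv/= !lte_fin ltrD2r.
by case: ifP => // _; rewrite -EFinB; congr EFin; ring.
Qed.

Lemma ge0_integral_dilation (k : R) (f : R -> \bar R) : (0 < k)%R ->
  measurable_fun [set: R] f -> (forall x, 0 <= f x) ->
  \int[mu]_x f x = k%:E * \int[mu]_x f (k * x)%R.
Proof.
move=> k0 mf f0.
pose phi : measurableTypeR R -> measurableTypeR R := fun x : R => (k * x)%R.
have mphi : measurable_fun setT phi by exact: measurable_funM.
transitivity (k%:E * \int[pushforward mu phi]_y f y); last first.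
  by rewrite ge0_integral_pushforward.
have k0' := ltW k0.
rewrite -(@ge0_integral_mscale _ _ _ _ _ _ (NngNum k0'))//.
apply: eq_measure_integral => //= A mA _.
apply: lebesgue_measure_unique => //= _ [[a b]] _ <-.
rewrite /mscale/= /pushforward /phi.
rewrite (_ : _ @^-1` _ = `](a / k)%R, (b / k)%R]%classic); last first.
  by apply/seteqP; split => x /=; rewrite !in_itv/= ltr_pdivrMr// ler_pdivlMr// (mulrC k).
rewrite !lebesgue_measure_itv/= !lte_fin ltr_pM2r ?invr_gt0//.
by case: ifP => // _; rewrite ?mule0// -!EFinB -EFinM; congr EFin; field; rewrite gt_eqF.
Qed.

End lebesgue_affine.

Section trunc_pow.
Context {R : realType}.
Local Notation mu := (@lebesgue_measure R).
Implicit Types (a b x u : R).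

(* Extending x `^ (a - 1) by 0 to x <= 0 lets integrals over simplices be written *)
(* as convolutions on the whole line.                                            *)
Definition trunc_pow a x : R := if 0 < x then x `^ (a - 1) else 0.

Lemma trunc_pow_ge0 a x : 0 <= trunc_pow a x.
Proof. by rewrite /trunc_pow; case: ifP => // _; exact: powR_ge0. Qed.

Lemma trunc_powE a x : 0 < x -> trunc_pow a x = x `^ (a - 1).
Proof. by rewrite /trunc_pow => ->. Qed.

Lemma trunc_pow_le0 a x : x <= 0 -> trunc_pow a x = 0.
Proof. by rewrite /trunc_pow leNgt => /negbTE ->. Qed.

Lemma measurable_trunc_pow a : measurable_fun [set: R] (trunc_pow a).
Proof.
apply: measurable_fun_ifT => //.
exact: measurable_fun_ltr.
Qed.

Lemma trunc_powM a k x : 0 < k ->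
  trunc_pow a (k * x) = k `^ (a - 1) * trunc_pow a x.
Proof.
move=> k0; have [x0|x0] := ltP 0 x.
  by rewrite !trunc_powE ?mulr_gt0// powRM// ltW.
by rewrite !trunc_pow_le0 ?mulr0// pmulr_rle0.
Qed.

Lemma trunc_powS a x : 0 < a -> x * trunc_pow a x = trunc_pow (a + 1) x.
Proof.
move=> a0; have [x0|x0] := ltP 0 x; last by rewrite !trunc_pow_le0// mulr0.
by rewrite !trunc_powE// mulr_powRB1// ?ltW// addrK.
Qed.

Lemma trunc_powX a x k : 0 < a ->
  x ^+ k * trunc_pow a x = trunc_pow (a + k%:R) x.
Proof.
move=> a0; elim: k => [|k IH]; first by rewrite expr0 mul1r addr0.
by rewrite exprS -mulrA IH trunc_powS -?natr1 ?addrA// ltr_wpDr.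
Qed.

Lemma continuous_powR a x : 0 < x -> {for x, continuous ((@powR R) ^~ a)}.
Proof.
move=> x0; apply: differentiable_continuous; apply/derivable1_diffP.
by apply: derivable_powR; rewrite in_itv/= x0.
Qed.

(** The integrand may be singular at 0, so the fundamental theorem of calculus is applied on the
    intervals [F n], which increase to []0, 1]]. *)
Lemma integral_trunc_pow01 a : (0 < a)%R ->
  (\int[mu]_x (trunc_pow a x * trunc_pow 1 (1 - x))%:E = (a^-1)%:E)%E.
Proof.
move=> a0.
(* With [n.+2] the left endpoint is strictly below 1 even for [n = 0]. *)
pose F (n : nat) := `[n.+2%:R^-1%R, 1%R : R]%classic.
have F01 n x : F n x -> (0 < x <= 1)%R.
  rewrite /F/= in_itv/= => /andP[nx ->]; rewrite andbT.
  by rewrite (lt_le_trans _ nx).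
have UF : \bigcup_n F n = `]0%R, 1%R]%classic.
  apply/seteqP; split => x /=.
    by move=> [n _ /F01]; rewrite in_itv.
  rewrite in_itv/= => /andP[x0 x1].
  exists (Num.truncn x^-1) => //; rewrite /F/= in_itv/= x1 andbT.
  rewrite -[leRHS]invrK lef_pV2 ?posrE ?invr_gt0//.
  by rewrite ltW// (lt_le_trans (truncnS_gt _))// ler_nat.
have mpow (D : set R) : measurable_fun D (fun x => (x `^ (a - 1))%:E).
  by apply/measurable_EFinP/measurable_funTS; exact: measurable_powR.
transitivity (\int[mu]_(x in `]0%R, 1%R]) (x `^ (a - 1))%:E)%E.
  rewrite -integral_itv_bndo_bndc// [RHS]integral_mkcond.
  apply: eq_integral => x _; rewrite patchE mem_setE in_itv/= /trunc_pow subr_gt0.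
  (* [trunc_pow 1 (1 - x)] is the indicator of [x < 1], since a zero exponent gives 1. *)
  by case: (0 < x)%R; case: (x < 1)%R => /=; rewrite ?mul0r ?mulr0// subrr powRr0 mulr1.
rewrite -UF.
have ndF : nondecreasing_seq F.
  move=> m n mn; rewrite subsetEset; apply: subset_itvr; rewrite bnd_simp.
  by rewrite lef_pV2 ?posrE// ler_nat !ltnS.
have /cvg_lim <- // : (\int[mu]_(x in F n) (x `^ (a - 1))%:E)%E @[n --> \oo] -->
    (\int[mu]_(x in \bigcup_n F n) (x `^ (a - 1))%:E)%E.
  apply: ge0_nondecreasing_set_cvg_integral => //.
  - by move=> n; exact: measurable_itv.
  - by move=> n; exact: mpow.
  - by move=> n x _; rewrite lee_fin powR_ge0.
apply/cvg_lim => //.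
rewrite [X in X @ _ --> _](_ : _ = fun n => (a^-1 - n.+2%:R^-1 `^ a / a)%R%:E).
  apply: cvg_EFin; first exact: nearW.
  rewrite -[X in _ --> X]subr0; apply: cvgB; first exact: cvg_cst.
  rewrite -[X in _ --> X](mul0r a^-1); apply: cvgMl.
  have /cvg_at_rightP/(_ (fun n => n.+2%:R^-1%R)) := powR_cvg0 a0.
  apply; split => [n|]; first by rewrite invr_gt0.
  by have := @cvg_harmonic R; rewrite -cvg_shiftS.
apply/funext => n.
have n01 : 0 < (n.+2%:R^-1 : R) < 1 by rewrite invr_gt0 ltr0n/= invf_lt1// ltr1n.
rewrite (@continuous_FTC2 _ _ (fun x => x `^ a / a)%R) ?powR1 ?div1r//.
- by case/andP : n01.
- apply: continuous_in_subspaceT => x; rewrite inE => /F01/andP[x0 _].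
  exact: continuous_powR.
- have cF x : (0 < x)%R -> {for x, continuous (fun x => x `^ a / a)%R}.
    by move=> x0; apply: cvgMl; exact: continuous_powR.
  split.
  + move=> x; rewrite in_itv/= => /andP[nx _]; apply: derivableM => //.
    apply: derivable_powR; rewrite in_itv/= andbT (lt_trans _ nx)//.
  + by apply: cvg_at_right_filter; apply: cF; case/andP : n01.
  + by apply: cvg_at_left_filter; exact: cF.
- move=> x; rewrite in_itv/= => /andP[nx _].
  have x0 : (0 < x)%R by rewrite (lt_trans _ nx).
  rewrite derive1Mr//; last by apply: derivable_powR; rewrite in_itv/= x0.
  by rewrite powR_derive1 ?in_itv/= ?x0// mulrAC divff ?mul1r// gt_eqF.
Qed.
End trunc_pow.

Section gamma_beta.
Context {R : realType}.
Local Notation mu := (@lebesgue_measure R).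
Implicit Types (a b x u : R).
Local Open Scope ereal_scope.

(** Extended-real values allow Tonelli's theorem before finiteness is known; [gamma_intE] identifies
    this with [Gamma] for [0 < a]. *)
Definition gamma_int a : \bar R := \int[mu]_x (trunc_pow a x * expR (- x))%:E.

Definition beta_int a b : \bar R :=
  \int[mu]_x (trunc_pow a x * trunc_pow b (1 - x))%:E.

Lemma gamma_int_ge0 a : 0 <= gamma_int a.
Proof.
by apply: integral_ge0 => x _; rewrite lee_fin mulr_ge0 ?trunc_pow_ge0 ?expR_ge0.
Qed.

Lemma beta_int_ge0 a b : 0 <= beta_int a b.
Proof.
by apply: integral_ge0 => x _; rewrite lee_fin mulr_ge0 ?trunc_pow_ge0.
Qed.

Lemma measurable_trunc_pow_comp d (T : measurableType d) a (f : T -> R) :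
  measurable_fun [set: T] f -> measurable_fun [set: T] (fun z => trunc_pow a (f z)).
Proof. by move=> mf; exact: measurableT_comp (measurable_trunc_pow a) mf. Qed.

Lemma measurable_conv_integrand a b u : measurable_fun [set: R]
  (fun z => (trunc_pow a z * trunc_pow b (u - z))%:E).
Proof.
apply/measurable_EFinP/measurable_funM; first exact: measurable_trunc_pow.
by apply: measurable_trunc_pow_comp; exact: measurable_funB.
Qed.

Lemma conv_integrand_ge0 a b u x : 0 <= (trunc_pow a x * trunc_pow b (u - x))%:E.
Proof. by rewrite lee_fin mulr_ge0 ?trunc_pow_ge0. Qed.

Lemma measurable_gamma_integrand a :
  measurable_fun [set: R] (fun x => (trunc_pow a x * expR (- x))%:E).
Proof.
apply/measurable_EFinP/measurable_funM; first exact: measurable_trunc_pow.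
by apply: measurableT_comp.
Qed.

Lemma gamma_integrand_ge0 a x : 0 <= (trunc_pow a x * expR (- x))%:E.
Proof. by rewrite lee_fin mulr_ge0 ?trunc_pow_ge0 ?expR_ge0. Qed.

(** For [0 < u], rescaling the variable by [u] pulls out the power [a + b - 1] of [u]. For [u <= 0]
    one of the two factors always vanishes. *)
Lemma trunc_pow_conv a b u :
  \int[mu]_x (trunc_pow a x * trunc_pow b (u - x))%:E =
  beta_int a b * (trunc_pow (a + b) u)%:E.
Proof.
have [u0|u0] := ltP 0%R u; last first.
  rewrite [in RHS]trunc_pow_le0// mule0 integral0_eq// => x _.
  have [x0|x0] := ltP 0%R x; last by rewrite trunc_pow_le0// mul0r.
  by rewrite [X in (_ * X)%R]trunc_pow_le0 ?mulr0// subr_le0 (le_trans u0)// ltW.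
have mF := measurable_conv_integrand a b; have F0 := conv_integrand_ge0 a b.
rewrite (ge0_integral_dilation u0)//.
under eq_integral => x _.
  rewrite -[X in (X - _)%R]mulr1 -mulrBr !trunc_powM// mulrACA EFinM; over.
rewrite ge0_integralZl_EFin ?mulr_ge0 ?powR_ge0//; last exact: mF.
rewrite muleA -EFinM muleC; congr (_ * _%:E).
rewrite trunc_powE// mulrA -[X in (X * _ * _)%R]powRr1 ?ltW//.
rewrite -!powRD ?(gt_eqF u0) ?implybT//; congr (_ `^ _)%R; ring.
Qed.

(** Shifting the second variable by the first merges the exponentials; after Tonelli the inner
    integral is the convolution of [trunc_pow_conv]. *)
Lemma gamma_beta a b : gamma_int a * gamma_int b = beta_int a b * gamma_int (a + b).
Proof.
have mF : measurable_fun [set: R * R]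
    (fun z => (trunc_pow a z.1 * trunc_pow b (z.2 - z.1) * expR (- z.2))%:E).
  apply/measurable_EFinP/measurable_funM; last first.
    by apply: measurableT_comp => //; exact: measurableT_comp.
  apply: measurable_funM; apply: measurable_trunc_pow_comp => //.
  exact: measurable_funB.
have F0 z : 0 <= (trunc_pow a z.1 * trunc_pow b (z.2 - z.1) * expR (- z.2))%:E.
  by rewrite lee_fin !mulr_ge0 ?trunc_pow_ge0 ?expR_ge0.
have mG := measurable_gamma_integrand; have G0 := gamma_integrand_ge0.
transitivity (\int[mu]_x \int[mu]_y
    (trunc_pow a x * trunc_pow b (y - x) * expR (- y))%:E).
  rewrite -ge0_integralZr//; [|exact: mG|exact: gamma_int_ge0].
  apply: eq_integral => x _.
  rewrite /gamma_int -(ge0_integral_translation (- x)%R (mG b) (G0 b)).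
  rewrite -ge0_integralZl//.
  - apply: eq_integral => y _; rewrite -EFinM; congr EFin.
    rewrite mulrACA -expRD; congr (_ * expR _)%R; ring.
  - apply: (measurableT_comp (mG b)); exact: measurable_funD.
rewrite (@fubini_tonelli _ _ _ _ _ mu mu _ mF F0).
rewrite -ge0_integralZl//; [|exact: mG|exact: beta_int_ge0].
apply: eq_integral => y _.
rewrite [in RHS]EFinM muleA -trunc_pow_conv -ge0_integralZr//.
- exact: measurable_conv_integrand.
- by move=> x _; exact: conv_integrand_ge0.
Qed.

Lemma gamma_int1 : gamma_int 1 = 1.
Proof.
rewrite -(integral_exponential_pdf (ltr01 : (0 < 1 :> R)%R)).
have mexp D : measurable_fun D (fun x : R => (expR (- x))%:E).
  by apply/measurable_EFinP/measurable_funTS; exact: measurableT_comp.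
transitivity (\int[mu]_(x in `]0%R, +oo[) (expR (- x))%:E).
  rewrite [RHS]integral_mkcond; apply: eq_integral => x _.
  rewrite patchE mem_setE in_itv/= andbT /trunc_pow subrr powRr0.
  by case: ifP => _; rewrite ?mul1r ?mul0r.
rewrite integral_itv_obnd_cbnd// integral_mkcond; apply: eq_integral => x _.
rewrite /exponential_pdf !patchE; case: ifP => // _.
by rewrite mul1r mulN1r.
Qed.

Lemma beta_int1 a : (0 < a)%R -> beta_int a 1 = (a^-1)%:E.
Proof. exact: integral_trunc_pow01. Qed.

(* Since B(a, 1) = 1 / a, this is an instance of gamma_beta. *)
Lemma gamma_intS a : (0 < a)%R -> gamma_int (a + 1) = a%:E * gamma_int a.
Proof.
move=> a0; have := gamma_beta a 1; rewrite gamma_int1 mule1 beta_int1// => ->.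
by rewrite muleA -EFinM divff ?gt_eqF// mul1e.
Qed.

Lemma gamma_intSn n : gamma_int n.+1%:R = (n`!%:R)%:E.
Proof.
elim: n => [|n IH]; first exact: gamma_int1.
by rewrite -natr1 gamma_intS// IH -EFinM -natrM factS.
Qed.

(** The functional equation replaces [a] by [a + 1], which removes the singularity at 0 and leaves a
    comparison with integer arguments. *)
Lemma gamma_int_fin a : (0 < a)%R -> gamma_int a \is a fin_num.
Proof.
move=> a0.
suff G1 : gamma_int (a + 1) < +oo.
  rewrite ge0_fin_numE ?gamma_int_ge0//; move: G1; rewrite gamma_intS//.
  by case: (gamma_int a) (gamma_int_ge0 a) => [r _|_|//]; rewrite ?ltry// gt0_muley ?lte_fin.
(* x ^ a <= 1 + x ^ n for n >= a *)
pose n := (Num.truncn a).+1.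
have an : (a <= n%:R)%R by rewrite ltW// truncnS_gt.
apply: (@le_lt_trans _ _ (gamma_int 1 + gamma_int n.+1%:R)); last first.
  by rewrite gamma_int1 gamma_intSn -EFinD ltry.
rewrite /gamma_int -ge0_integralD//; first last.
- exact: measurable_gamma_integrand.
- by move=> x _; exact: gamma_integrand_ge0.
- exact: measurable_gamma_integrand.
- by move=> x _; exact: gamma_integrand_ge0.
apply: ge0_le_integral => //.
- by move=> x _; exact: gamma_integrand_ge0.
- exact: measurable_gamma_integrand.
- by apply: emeasurable_funD; exact: measurable_gamma_integrand.
move=> x _; rewrite -EFinD lee_fin -mulrDl ler_wpM2r ?expR_ge0//.
rewrite /trunc_pow; case: ifPn => x0; last by rewrite addr0.
rewrite subrr powRr0 addrK -natr1 addrK.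
have [x1|/ltW x1] := leP x 1%R.
  rewrite -[leLHS]addr0 lerD ?powR_ge0//.
  by rewrite (le_trans (ge0_ler_powR (ltW a0) _ _ x1)) ?powR1// ?nnegrE ltW.
by rewrite -[leLHS]add0r lerD// ler_powR.
Qed.

Lemma gamma_int_gt0 a : (0 < a)%R -> 0 < gamma_int a.
Proof.
move=> a0.
suff G1 : 0 < gamma_int (a + 1).
  rewrite lt_neqAle gamma_int_ge0 andbT; apply/eqP => G0.
  by move: G1; rewrite gamma_intS// -G0 mule0 ltxx.
(* On [[1, 2]] the power is at least 1 and the exponential at least [expR (- 2)]. *)
apply: (@lt_le_trans _ _ (\int[mu]_(x in `[1%R, 2%R]) (expR (- 2))%:E)).
  rewrite integral_cst//= lebesgue_measure_itv/= lte_fin.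
  rewrite (_ : (1 < 2)%R)%R ?ltr1n// -EFinB -EFinM lte_fin mulr_gt0 ?expR_gt0//.
apply: (@le_trans _ _ (\int[mu]_(x in `[1%R, 2%R]) (trunc_pow (a + 1) x * expR (- x))%:E)).
  apply: ge0_le_integral => //.
  - by apply: measurable_funTS; exact: measurable_gamma_integrand.
  - move=> x /=; rewrite in_itv/= => /andP[x1 x2].
    rewrite lee_fin trunc_powE ?(lt_le_trans _ x1)// addrK.
    rewrite -[leLHS]mul1r ler_pM ?expR_ge0// ?ler_expR ?lerN2//.
    by rewrite -[leLHS](powRr0 x) ler_powR// ltW.
apply: ge0_subset_integral => //; first exact: measurable_gamma_integrand.
by move=> x _; exact: gamma_integrand_ge0.
Qed.

(** [Gamma] is the [fine] part of an extended-real integral, so this rests on [gamma_int_fin]. *)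
Lemma gamma_intE a : (0 < a)%R -> gamma_int a = (Gamma a)%:E.
Proof.
move=> a0; rewrite -[LHS]fineK ?gamma_int_fin//; congr (_%:E).
rewrite /Gamma /Rintegral; congr fine.
rewrite [RHS]integral_mkcond; apply: eq_integral => x _.
rewrite patchE mem_setE in_itv/= andbT /trunc_pow.
by case: ifP => _; rewrite ?mul0r.
Qed.

End gamma_beta.

Section Gamma_theory.
Context {R : realType}.
Implicit Types a b : R.

Lemma Gamma_gt0 a : 0 < a -> 0 < Gamma a.
Proof. by move=> a0; rewrite -lte_fin -gamma_intE// gamma_int_gt0. Qed.

Lemma GammaS a : 0 < a -> Gamma (a + 1) = a * Gamma a.
Proof.
move=> a0; apply: EFin_inj.
by rewrite EFinM -!gamma_intE ?gamma_intS ?addr_gt0.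
Qed.

Lemma Gamma_nat n : Gamma (n.+1%:R : R) = n`!%:R.
Proof. by apply: EFin_inj; rewrite -gamma_intE// gamma_intSn. Qed.

Lemma Gamma_rising a k : 0 < a ->
  Gamma (a + k%:R) = Gamma a * \prod_(i < k) (a + i%:R).
Proof.
move=> a0; elim: k => [|k IH]; first by rewrite addr0 big_ord0 mulr1.
rewrite -natr1 addrA GammaS ?ltr_wpDr// IH big_ord_recr/=; ring.
Qed.

Lemma beta_intE a b : 0 < a -> 0 < b ->
  beta_int a b = (Gamma a * Gamma b / Gamma (a + b))%:E.
Proof.
move=> a0 b0; have ab0 : 0 < a + b by rewrite addr_gt0.
have := gamma_beta a b; rewrite !gamma_intE//.
move=> /(congr1 (fun x => x * ((Gamma (a + b))^-1)%:E)%E).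
rewrite -!EFinM => ->; rewrite -muleA -EFinM divff ?mule1//.
by rewrite gt_eqF// Gamma_gt0.
Qed.

End Gamma_theory.

(** * Dirichlet integrals and null hyperplanes in [R^n] *)

Section lebesgue_tuple_theory.
Context {R : realType}.
Local Notation mu := (@lebesgue_measure R).

Lemma ge0_integral_lebesgue_tupleS n (f : n.+1.-tuple R -> \bar R) :
  measurable_fun [set: n.+1.-tuple R] f -> (forall v, 0 <= f v)%E ->
  (\int[lebesgue_tuple R n.+1]_v f v =
   \int[mu]_x \int[lebesgue_tuple R n]_v f (cons_pair (x, v)))%E.
Proof.
move=> mf f0; have mc := @measurable_cons_pair R n.
rewrite /= /lebesgue_cons ge0_integral_pushforward//.
rewrite fubini_tonelli1//.
- exact: measurableT_comp mf mc.
- by move=> x; exact: f0.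
Qed.

Lemma measurable_coord n (i : 'I_n) :
  measurable_fun [set: n.-tuple R] (fun v => tnth v i).
Proof. exact: measurable_tnth. Qed.

Lemma measurable_coord_sum n : measurable_fun [set: n.-tuple R] (@coord_sum R n).
Proof. by apply: measurable_sum => i; exact: measurable_coord. Qed.

Lemma tnth_cons0 n (p : R * n.-tuple R) : tnth (cons_pair p) ord0 = p.1.
Proof. by []. Qed.

Lemma tnth_consS n (p : R * n.-tuple R) i :
  tnth (cons_pair p) (lift ord0 i) = tnth p.2 i.
Proof. by rewrite /cons_pair tnthS. Qed.

Lemma coord_sum_cons n (p : R * n.-tuple R) :
  coord_sum (cons_pair p) = p.1 + coord_sum p.2.
Proof.
rewrite /coord_sum big_ord_recl tnth_cons0; congr (_ + _).
by apply: eq_bigr => i _; rewrite tnth_consS.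
Qed.

(* Unnormalised Dirichlet density of the simplex {v >= 0, coord_sum v <= u}. *)
Definition dirichlet_kernel n (b : 'I_n -> R) (b0 u : R) (v : n.-tuple R) : R :=
  \prod_(i < n) trunc_pow (b i) (tnth v i) * trunc_pow b0 (u - coord_sum v).

Lemma dirichlet_kernel_ge0 n (b : 'I_n -> R) (b0 u : R) v : 0 <= dirichlet_kernel b b0 u v.
Proof. by rewrite mulr_ge0 ?trunc_pow_ge0 ?prodr_ge0// => i _; exact: trunc_pow_ge0. Qed.

Lemma measurable_dirichlet_kernel n (b : 'I_n -> R) (b0 u : R) :
  measurable_fun [set: n.-tuple R] (dirichlet_kernel b b0 u).
Proof.
apply: measurable_funM.
  apply: measurable_prod => i _; apply: measurable_trunc_pow_comp.
  exact: measurable_coord.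
apply: measurable_trunc_pow_comp; apply: measurable_funB => //.
exact: measurable_coord_sum.
Qed.

Lemma dirichlet_kernel_cons n (b : 'I_n.+1 -> R) (b0 u : R) (p : R * n.-tuple R) :
  dirichlet_kernel b b0 u (cons_pair p) =
  trunc_pow (b ord0) p.1 * dirichlet_kernel (b \o lift ord0) b0 (u - p.1) p.2.
Proof.
rewrite /dirichlet_kernel big_ord_recl tnth_cons0 coord_sum_cons opprD addrA mulrA.
by do 2 congr (_ * _); apply: eq_bigr => i _; rewrite tnth_consS.
Qed.

(** Induction on [n]: with the first coordinate fixed at [x], the inner integral is a constant times
    a truncated power of [u - x], and the remaining integral over [x] is [trunc_pow_conv]. The
    general [u] is what the induction needs. *)
Lemma dirichlet_integral n (b : 'I_n -> R) (b0 u : R) : (forall i, 0 < b i) -> 0 < b0 ->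
  (\int[lebesgue_tuple R n]_v (dirichlet_kernel b b0 u v)%:E =
   (\prod_(i < n) Gamma (b i) * Gamma b0 / Gamma (\sum_(i < n) b i + b0)
     * trunc_pow (\sum_(i < n) b i + b0) u)%:E)%E.
Proof.
elim: n b u => [|n IH] b u b_gt0 b0_gt0.
  rewrite /= integral_dirac//; last first.
    by apply/measurable_EFinP; exact: measurable_dirichlet_kernel.
  rewrite diracE mem_set// mul1e /dirichlet_kernel /coord_sum !big_ord0.
  by rewrite !mul1r subr0 add0r divff ?mul1r// gt_eqF// Gamma_gt0.
have mk : measurable_fun setT (EFin \o dirichlet_kernel b b0 u).
  by apply/measurable_EFinP; exact: measurable_dirichlet_kernel.
rewrite ge0_integral_lebesgue_tupleS//; last first.
  by move=> v; rewrite lee_fin dirichlet_kernel_ge0.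
set B := \sum_(i < n) b (lift ord0 i) + b0.
have B0 : 0 < B by rewrite ltr_wpDl// sumr_ge0// => i _; exact: ltW.
pose C := \prod_(i < n) Gamma (b (lift ord0 i)) * Gamma b0 / Gamma B.
have C0 : 0 <= C.
  by rewrite mulr_ge0 ?invr_ge0 ?mulr_ge0 ?prodr_ge0// => *; rewrite ltW ?Gamma_gt0.
transitivity (\int[mu]_x (C%:E * (trunc_pow (b ord0) x * trunc_pow B (u - x))%:E))%E.
  apply: eq_integral => x _.
  under eq_integral do rewrite dirichlet_kernel_cons/= EFinM.
  rewrite ge0_integralZl_EFin ?trunc_pow_ge0//; last 2 first.
  - by move=> v _; rewrite lee_fin dirichlet_kernel_ge0.
  - by apply/measurable_EFinP; exact: measurable_dirichlet_kernel.
  rewrite (IH (b \o lift ord0))//; last by move=> i; exact: b_gt0.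
  rewrite -!EFinM; congr EFin.
  by rewrite mulrCA.
rewrite ge0_integralZl_EFin//; last 2 first.
- by move=> x _; exact: conv_integrand_ge0.
- exact: measurable_conv_integrand.
rewrite trunc_pow_conv beta_intE// -!EFinM; congr EFin.
rewrite !big_ord_recl -addrA -/B mulrA; congr (_ * _).
have : Gamma B != 0 by rewrite gt_eqF// Gamma_gt0.
rewrite /C; move: (Gamma _) (Gamma _) (Gamma _) (Gamma _) (\prod_(_ < _) _) => g h k q p k0.
by rewrite mulrA mulrACA mulrAC [_ * k]mulrC; congr (_ / _); field.
Qed.

Lemma measurable_affine_form n (c : 'I_n -> R) :
  measurable_fun [set: n.-tuple R] (fun v => \sum_(i < n) c i * tnth v i).
Proof.
by apply: measurable_sum => i; apply: measurable_funM => //; exact: measurable_coord.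
Qed.

Lemma measurable_hyperplane n (c : 'I_n -> R) (t : R) :
  measurable [set v : n.-tuple R | \sum_(i < n) c i * tnth v i = t].
Proof.
have := measurable_affine_form c measurableT (measurable_set1 t).
by rewrite setTI.
Qed.

(* Fubini: all sections along the first coordinate are null, except possibly the *)
(* one at x = t / c_0 when c_0 is the only nonzero coefficient.                  *)
Lemma hyperplane_null n (c : 'I_n -> R) (t : R) :
  t != 0 \/ (exists i, c i != 0) ->
  lebesgue_tuple R n [set v | \sum_(i < n) c i * tnth v i = t] = 0%E.
Proof.
elim: n c t => [|n IH] c t ct.
  have t0 : t != 0 by case: ct => // -[[]].
  rewrite (_ : [set v | _] = set0) ?measure0// -subset0 => v /=.
  by rewrite big_ord0 => /esym/eqP; rewrite (negbTE t0).
have mH := measurable_hyperplane c t.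
set H := [set v | _] in mH *.
transitivity (\int[lebesgue_tuple R n.+1]_v (\1_H v)%:E)%E.
  by rewrite integral_indic// setIT.
rewrite ge0_integral_lebesgue_tupleS; last 2 first.
- by apply/measurable_EFinP; exact: measurable_indic.
- by move=> v; rewrite lee_fin.
(* When [c ord0 = 0] this is the default value 0, and excluding that one point is harmless. *)
pose x0 := t / c ord0.
rewrite (ae_eq_integral (cst 0%E)) ?integral0//.
- apply: (@measurable_fun_fubini_tonelli_F _ _ _ _ R (lebesgue_tuple R n)
    (fun p => (\1_H (cons_pair p))%:E)) => /=; last by move=> p; rewrite lee_fin.
  apply: (@measurableT_comp _ _ _ _ _ _ (fun v => (\1_H v)%:E) _ (@cons_pair R n)).
    by apply/measurable_EFinP; exact: measurable_indic.
  exact: measurable_cons_pair.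
exists [set x0]; split => //; first exact: lebesgue_measure_set1.
move=> x /= /not_implyP[_ xN0]; apply: contrapT => xx0; apply: xN0.
rewrite -[RHS](IH (c \o lift ord0) (t - c ord0 * x)).
- set H' := [set v | _].
  transitivity (\int[lebesgue_tuple R n]_v (\1_H' v)%:E)%E; last first.
    by rewrite integral_indic ?setIT//; exact: measurable_hyperplane.
  apply: eq_integral => v _; congr (_%:E); rewrite !indicE; congr (_%:R).
  congr nat_of_bool; apply/idP/idP; rewrite !inE /H /H' /= big_ord_recl tnth_cons0 /=.
  + by move=> <-; rewrite addrAC subrr add0r; apply: eq_bigr => i _; rewrite tnth_consS.
  + move=> E; rewrite (_ : \sum_(i < n) _ = t - c ord0 * x) ?subrKC// -E.
    by apply: eq_bigr => i _; rewrite tnth_consS.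
- have [c0|c0] := eqVneq (c ord0) 0; last first.
    left; apply/eqP => /eqP; rewrite subr_eq0 => /eqP E; apply: xx0.
    by rewrite /x0 E mulrAC divff ?mul1r.
  case: ct => [t0|[i ci]]; first by left; rewrite c0 mul0r subr0.
  right; case: (unliftP ord0 i) ci => [j ->|-> /=] cj; first by exists j.
  by rewrite c0 eqxx in cj.
Qed.

End lebesgue_tuple_theory.

(** * The Dirichlet limit *)

Section polya_mixture.
Context {R : realType} (r : nat) (a : 'I_r.+1 -> R).
Hypotheses (a_gt0 : forall c, 0 < a c) (a_sum1 : \sum_c a c = 1).
Implicit Types (v : r.-tuple R).

(** Colour 0 receives the mass left over by [v]. Outside the simplex some values are negative,
    though they still sum to 1. *)
Definition simplex_prob v (c : 'I_r.+1) : R :=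
  if unlift ord0 c is Some m then tnth v m else 1 - coord_sum v.

Lemma simplex_prob0 v : simplex_prob v ord0 = 1 - coord_sum v.
Proof. by rewrite /simplex_prob unlift_none. Qed.

Lemma simplex_prob_lift v m : simplex_prob v (lift ord0 m) = tnth v m.
Proof. by rewrite /simplex_prob liftK. Qed.

Lemma simplex_prob_sum1 v : \sum_c simplex_prob v c = 1.
Proof.
rewrite big_ord_recl simplex_prob0 (eq_bigr (tnth v)) ?subrK// => m _.
by rewrite simplex_prob_lift.
Qed.

Lemma measurable_simplex_prob c :
  measurable_fun [set: r.-tuple R] (fun v => simplex_prob v c).
Proof.
rewrite /simplex_prob; case: (unlift ord0 c) => [m|]; first exact: measurable_coord.
by apply: measurable_funB => //; exact: measurable_coord_sum.
Qed.

Lemma measurable_word_prob n (w : {ffun 'I_n -> 'I_r.+1}) :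
  measurable_fun [set: r.-tuple R] (fun v => word_prob (simplex_prob v) w).
Proof. by apply: measurable_prod => j _; exact: measurable_simplex_prob. Qed.

Definition dirichlet_density : r.-tuple R -> R :=
  dirichlet_kernel (fun m => a (lift ord0 m)) (a ord0) 1.

Lemma dirichlet_density_ge0 v : 0 <= dirichlet_density v.
Proof. exact: dirichlet_kernel_ge0. Qed.

Lemma measurable_dirichlet_density : measurable_fun setT dirichlet_density.
Proof. exact: measurable_dirichlet_kernel. Qed.

Lemma dirichlet_densityE v :
  dirichlet_density v = \prod_c trunc_pow (a c) (simplex_prob v c).
Proof.
rewrite big_ord_recl simplex_prob0 mulrC; congr (_ * _).
by apply: eq_bigr => m _; rewrite simplex_prob_lift.
Qed.

Lemma dirichlet_density_gt0 v : dirichlet_density v != 0 ->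
  forall c, 0 < simplex_prob v c.
Proof.
rewrite dirichlet_densityE => + c; rewrite (bigD1 c)//= mulf_eq0 negb_or => /andP[+ _].
by rewrite ltNge; apply: contraNN => /trunc_pow_le0 ->.
Qed.

Lemma sum_colour_count n (w : {ffun 'I_n -> 'I_r.+1}) :
  (\sum_c #|[set j | w j == c]%SET| = n)%N.
Proof.
rewrite -[RHS]card_ord -sum1_card (partition_big w xpredT)//=; apply: eq_bigr => c _.
by rewrite sum1dep_card.
Qed.

(** Conjugacy: multiplying by an i.i.d. word probability raises each Dirichlet parameter by the
    count of its colour. *)
Lemma dirichlet_density_word n (w : {ffun 'I_n -> 'I_r.+1}) v :
  dirichlet_density v * word_prob (simplex_prob v) w =
  dirichlet_kernel
    (fun m => a (lift ord0 m) + #|[set j | w j == lift ord0 m]%SET|%:R)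
    (a ord0 + #|[set j | w j == ord0]%SET|%:R) 1 v.
Proof.
rewrite dirichlet_densityE word_probE -big_split/= big_ord_recl mulrC.
congr (_ * _); last by rewrite simplex_prob0 mulrC trunc_powX.
by apply: eq_bigr => m _; rewrite simplex_prob_lift mulrC trunc_powX.
Qed.

Lemma dirichlet_density_word_ge0 n (w : {ffun 'I_n -> 'I_r.+1}) v :
  0 <= dirichlet_density v * word_prob (simplex_prob v) w.
Proof. by rewrite dirichlet_density_word dirichlet_kernel_ge0. Qed.

Lemma polya_mixture n (w : {ffun 'I_n -> 'I_r.+1}) :
  (\int[lebesgue_tuple R r]_v
     (dirichlet_density v * word_prob (simplex_prob v) w)%:E =
   (\prod_c Gamma (a c) * (\prod_(c : 'I_r.+1)
      \prod_(i < #|[set j | w j == c]%SET|) (a c + i%:R) / n`!%:R))%:E)%E.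
Proof.
under eq_integral do rewrite dirichlet_density_word.
rewrite dirichlet_integral => [|m|]; [|exact: ltr_wpDr|exact: ltr_wpDr].
congr EFin.
(* The parameters [a c] sum to 1 and the counts to [n], so the denominator is the Gamma value at
   [n + 1], that is [n!]. *)
have -> : \sum_(m < r) (a (lift ord0 m) + #|[set j | w j == lift ord0 m]%SET|%:R) +
    (a ord0 + #|[set j | w j == ord0]%SET|%:R) = n.+1%:R.
  rewrite addrC -(big_ord_recl r (fun c => a c + #|[set j | w j == c]%SET|%:R)).
  by rewrite big_split/= a_sum1 -natr_sum sum_colour_count addrC natr1.
rewrite trunc_powE// powR1 mulr1 Gamma_nat mulrA -big_split/= big_ord_recl mulrC.
rewrite mulrC; congr (_ / _).
rewrite mulrC Gamma_rising//; congr (_ * _).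
by apply: eq_bigr => m _; rewrite Gamma_rising.
Qed.

(** The case of the empty word in [polya_mixture]. *)
Lemma dirichlet_density_integral :
  (\int[lebesgue_tuple R r]_v (dirichlet_density v)%:E = (\prod_c Gamma (a c))%:E)%E.
Proof.
have := polya_mixture [ffun j : 'I_0 => ord0].
under eq_integral do rewrite /word_prob big_ord0 mulr1.
move=> ->; congr EFin; rewrite fact0 divr1 [X in _ * X]big1 ?mulr1// => c _.
by rewrite (_ : #|_| = 0%N) ?big_ord0//; apply: eq_card0 => -[].
Qed.

Lemma integrable_dirichlet_density :
  (lebesgue_tuple R r).-integrable setT (EFin \o dirichlet_density).
Proof.
apply/integrableP; split.
  by apply/measurable_EFinP; exact: measurable_dirichlet_density.
under eq_integral do rewrite /= ger0_norm ?dirichlet_density_ge0//.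
by rewrite dirichlet_density_integral ltry.
Qed.

End polya_mixture.

(** * Passage to the limit *)

Section dirichlet_limit.
Context {R : realType} (theta : R) (l : nat) (t : l.-tuple R).
Hypotheses (theta_gt0 : 0 < theta) (l_gt0 : (0 < l)%N).
Hypothesis t_gt0 : forall i, 0 < tnth t i.
Local Notation r := (2 ^ l - 1)%N.
Local Notation a := (fun c : 'I_r.+1 => exponent l theta c).
Local Notation mu := (lebesgue_tuple R r).
Implicit Types v : r.-tuple R.

Let a_gt0 c : 0 < a c. Proof. exact: exponent_gt0. Qed.
Let a_sum1 : \sum_c a c = 1. Proof. exact: exponent_sum1. Qed.

Lemma digit_prob_simplex v (i : 'I_l) :
  digit_prob (simplex_prob v) i =
  \sum_(m < r) (binary_digit i m.+1)%:R * tnth v m.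
Proof.
rewrite /digit_prob big_mkcond/= big_ord_recl/= {1}/binary_digit div0n/= add0r.
apply: eq_bigr => m _; rewrite simplex_prob_lift /bump/= add1n.
by case: (binary_digit _ _); rewrite ?mul1r ?mul0r.
Qed.

(** Only the constraints coming from [t]: the simplex constraints in [Omega t] are enforced by
    [dirichlet_density], which vanishes off the open simplex. *)
Definition digit_region : set (r.-tuple R) :=
  [set v | forall i : 'I_l, digit_prob (simplex_prob v) i <= tnth t i].

Lemma measurable_digit_prob i :
  measurable_fun [set: r.-tuple R] (fun v => digit_prob (simplex_prob v) i).
Proof.
under eq_fun do rewrite digit_prob_simplex.
exact: (measurable_affine_form (fun m : 'I_r => (binary_digit i m.+1)%:R)).
Qed.

Lemma measurable_digit_region : measurable digit_region.
Proof.
rewrite (_ : digit_region = \bigcap_(i in [set: 'I_l])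
    [set v | digit_prob (simplex_prob v) i <= tnth t i]); last first.
  by apply/seteqP; split => v /= h i; [move=> _|]; exact: h.
apply: fin_bigcap_measurable => // i _.
rewrite (_ : [set v | _] = (fun v => digit_prob (simplex_prob v) i) @^-1` `]-oo, tnth t i]).
  by rewrite -[X in measurable X]setTI; apply: measurable_digit_prob.
by apply/seteqP; split => v /=; rewrite in_itv.
Qed.

Lemma Omega_simplex v : Omega t v -> forall c, 0 <= simplex_prob v c.
Proof.
move=> [v01 _ s1] c; case: (unliftP ord0 c) => [m ->|->].
  by rewrite simplex_prob_lift; have /andP[] := v01 m.
by rewrite simplex_prob0 subr_ge0.
Qed.

(** In the interior the two formulas coincide. Where some simplex coordinate is 0 both vanish,
    because a nonzero power of 0 is 0. *)
Lemma density_Omega v : Omega t v -> density theta v = dirichlet_density a v.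
Proof.
move=> Ov; have p0 := Omega_simplex Ov.
have E (c : 'I_r.+1) : trunc_pow (a c) (simplex_prob v c) = simplex_prob v c `^ (a c - 1).
  have := p0 c; rewrite le_eqVlt => /predU1P[<-|/trunc_powE//].
  by rewrite trunc_pow_le0// powR0// subr_eq0 lt_eqF// exponent_lt1.
rewrite dirichlet_densityE (eq_bigr _ (fun c _ => E c)) big_ord_recl mulrC.
rewrite /density simplex_prob0; congr (_ * (_ `^ (_ - 1))).
  apply: eq_bigr => m _; rewrite simplex_prob_lift; congr (_ `^ (_ - 1)).
by rewrite /exponent/= /digit_sum big_ord0 expr0 mul1r.
Qed.

Lemma simplex_Omega v : (forall c, 0 < simplex_prob v c) -> digit_region v -> Omega t v.
Proof.
move=> p0 Dv.
have v0 m : 0 < tnth v m by have := p0 (lift ord0 m); rewrite simplex_prob_lift.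
have s1 : coord_sum v <= 1 by rewrite ltW// -subr_gt0 -simplex_prob0.
split => // [m|i]; last by rewrite -digit_prob_simplex.
rewrite ltW//= (le_trans _ s1)// /coord_sum (bigD1 m)//= lerDl sumr_ge0// => j _.
exact: ltW.
Qed.

Lemma integral_density :
  (\int[mu]_(v in Omega t) (density theta v)%:E =
   \int[mu]_v (dirichlet_density a v * \1_digit_region v)%:E)%E.
Proof.
rewrite integral_mkcond; apply: eq_integral => v _; rewrite patchE indicE.
have [/set_mem Ov|OvN] := boolP (v \in Omega t).
  rewrite density_Omega// mem_set ?mulr1//.
  by move=> i; rewrite digit_prob_simplex; case: Ov.
have [Dv|] := boolP (v \in digit_region); last by rewrite mulr0.
rewrite mulr1; apply/esym; congr EFin; apply/eqP; apply: contraNT OvN.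
by move=> /dirichlet_density_gt0 p0; apply/mem_set/simplex_Omega => //; exact/set_mem.
Qed.

Lemma digit_hyperplane_null i :
  mu [set v | digit_prob (simplex_prob v) i = tnth t i] = 0%E.
Proof.
rewrite -[RHS](@hyperplane_null R r (fun m => (binary_digit i m.+1)%:R) (tnth t i)).
  by congr (mu _); apply/seteqP; split => v /=; rewrite digit_prob_simplex.
by left; rewrite gt_eqF.
Qed.

Lemma admissible_prob_cvg v : (forall c, 0 <= simplex_prob v c) ->
  (forall i, digit_prob (simplex_prob v) i <> tnth t i) ->
  admissible_prob t (simplex_prob v) n @[n --> \oo] --> (\1_digit_region v : R).
Proof.
move=> p0 qt.
have -> : (\1_digit_region v : R) = [forall i, digit_prob (simplex_prob v) i < tnth t i]%:R.
  rewrite indicE; congr (_%:R); congr nat_of_bool; apply/idP/forallP => [/set_mem Dv i|lt].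
    by rewrite lt_neqAle Dv andbT; exact/eqP.
  by apply/mem_set => i; exact: ltW.
pose K := \sum_i ((digit_prob (simplex_prob v) i - tnth t i) ^+ 2)^-1.
have K0 : K * n.+1%:R^-1 @[n --> \oo] --> (0 : R).
  by rewrite -[X in _ --> X](mulr0 K); apply: cvgMr; exact: cvg_harmonic.
(* [admissible_prob_dist] requires [0 < n], hence the shift to [n.+1]. *)
rewrite -cvg_shiftS; apply/cvgrPdist_le => e e0; move/cvgrPdist_le/(_ _ e0) : K0.
apply: filterS => n; rewrite sub0r normrN distrC => /(le_trans (ler_norm _)).
apply: le_trans; apply: admissible_prob_dist => //.
- exact: simplex_prob_sum1.
- by move=> i; exact/eqP.
Qed.

Lemma expectation_integral n :
  (uniform_expectation (fun s : {perm 'I_n} => \prod_(i < l) X theta s (tnth t i)))%:E =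
  ((\prod_(0 <= m < r.+1) (Gamma (exponent l theta m))^-1)%:E *
   \int[mu]_v (dirichlet_density a v * admissible_prob t (simplex_prob v) n)%:E)%E.
Proof.
rewrite expectation_prod_X//.
(* [big_filter] moves the condition on words into the index list, the form in which sum and integral
   are exchanged. *)
under eq_integral do rewrite /admissible_prob mulr_sumr -sumEFin -big_filter.
rewrite ge0_integral_sum//; last 2 first.
- move=> w; apply/measurable_EFinP/measurable_funM.
    exact: measurable_dirichlet_density.
  exact: measurable_word_prob.
- by move=> w v _; rewrite lee_fin dirichlet_density_word_ge0.
rewrite big_filter (eq_bigr _ (fun w _ => polya_mixture a_gt0 a_sum1 w)).
rewrite sumEFin -EFinM; congr EFin; rewrite -mulr_sumr mulrA big_mkord.
rewrite -big_split/= [X in _ = X * _]big1 ?mul1r// => c _.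
by rewrite mulVf// gt_eqF// Gamma_gt0.
Qed.

End dirichlet_limit.

Theorem corollary3 (R : realType) (theta : R) (l : nat) (t : l.-tuple R)
    (theta_gt0 : 0 < theta) (l_ge1 : (1 <= l)%N)
    (t_itv : forall i : 'I_l, 0 < tnth t i <= 1) :
  (uniform_expectation
     (fun s : {perm 'I_n} => \prod_(i < l) X theta s (tnth t i)))%:E
    @[n --> \oo] -->
  ((\prod_(0 <= m < (2 ^ l - 1).+1) (Gamma (exponent l theta m))^-1)%:E *
   \int[lebesgue_tuple R (2 ^ l - 1)]_(v in Omega t) (density theta v)%:E)%E.
Proof.
have t_gt0 i : 0 < tnth t i by case/andP: (t_itv i).
pose a (c : 'I_(2 ^ l - 1).+1) := exponent l theta c.
have a_gt0 c : 0 < a c by exact: exponent_gt0.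
have a_sum1 : \sum_c a c = 1 by exact: exponent_sum1.
under eq_cvg do rewrite expectation_integral//.
rewrite integral_density//; apply: cvgeZl => //.
pose f n v := (dirichlet_density a v * admissible_prob t (simplex_prob v) n)%:E.
have mdens := measurable_dirichlet_density a.
have [] // := @dominated_convergence _ _ R (lebesgue_tuple R (2 ^ l - 1)) setT measurableT
  f (fun v => (dirichlet_density a v * \1_(digit_region t) v)%:E)
  (EFin \o dirichlet_density a).
- move=> n; apply/measurable_EFinP/measurable_funM => //.
  under eq_fun do rewrite /admissible_prob big_mkcond/=.
  apply: measurable_sum => w; case: (admissible t w); last exact: measurable_cst.
  exact: measurable_word_prob.
- apply/measurable_EFinP/measurable_funM => //.
  by apply: measurable_indic; exact: measurable_digit_region.
- have : {ae lebesgue_tuple R (2 ^ l - 1),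
      forall v, forall i : 'I_l, digit_prob (simplex_prob v) i <> tnth t i}.
    apply: filter_forall => i.
    exists [set v | digit_prob (simplex_prob v) i = tnth t i]; split.
    + have := measurable_digit_prob i measurableT (measurable_set1 (tnth t i)).
      by rewrite setTI.
    + exact: digit_hyperplane_null.
    + by move=> v /= /contrapT.
  apply: filterS => v qt _; rewrite /f; apply: cvg_EFin; first exact: nearW.
  suff : dirichlet_density a v * admissible_prob t (simplex_prob v) n @[n --> \oo] -->
    dirichlet_density a v * \1_(digit_region t) v by [].
  (* Where the density vanishes the sequence is constantly 0; elsewhere [simplex_prob v] is a
     genuine probability vector and the law of large numbers applies. *)
  have [->|/dirichlet_density_gt0 p0] := eqVneq (dirichlet_density a v) 0.
    by rewrite mul0r; under eq_cvg do rewrite mul0r; exact: cvg_cst.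
  by apply: cvgMr; apply: admissible_prob_cvg => // c; exact: ltW.
- exact: integrable_dirichlet_density.
- apply: aeW => v n _; rewrite /f lee_fin.
  have [->|dv0] := eqVneq (dirichlet_density a v) 0; first by rewrite mul0r normr0.
  have p0 := dirichlet_density_gt0 dv0.
  have /andP[P0 P1] := admissible_prob_itv t (simplex_prob_sum1 v) (fun c => ltW (p0 c)) n.
  have d0 := dirichlet_density_ge0 a v.
  by rewrite ger0_norm ?ler_piMr// (mulr_ge0 d0 P0).
Qed.
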